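(* Let $\mu$ be any critical offspring distribution. Then, as $n\to\infty$ along integers $n$ with $\mathbf P(|\mathrm{T}|=n)>0$, \[ \mathsf{Height}(\mathrm{T}_n)=\omega_{\mathbf P}(\ln n)\qquad\text{and}\qquad \mathsf{Width}(\mathrm{T}_n)=o_{\mathbf P}(n). \] That is, $\mathsf{Height}(\mathrm{T}_n)/\ln n\to\infty$ in probability and $\mathsf{Width}(\mathrm{T}_n)/n\to 0$ in probability.
   Context: An offspring distribution is a probability measure $\mu=(\mu_k)_{k\ge 0}$ on $\mathbb Z_+=\{0,1,2,\dots\}$; it is critical if $\sum_{k\ge0}k\mu_k=1$. A $\mu$-Bienaymé tree $\mathrm{T}=\mathrm{T}(\mu)$ is the family tree of a Galton–Watson branching process with offspring distribution $\mu$ started from one individual (a random rooted plane tree with $\mathbf P(\mathrm{T}=\mathrm t)=\prod_{u\in\mathrm t}\mu_{k_u(\mathrm t)}$ for each finite plane tree $\mathrm t$, where $k_u(\mathrm t)$ is the number of children of $u$). For $n$ with $\mathbf P(|\mathrm T|=n)>0$, $\mathrm T_n$ denotes $\mathrm T$ conditioned to have exactly $n$ vertices. The height $\mathsf{Height}(\mathrm t)$ of a rooted tree is the largest distance of a vertex from the root; the width $\mathsf{Width}(\mathrm t)$ is the largest number of vertices in a single generation (at a single distance from the root). *)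

(* Defs.v *)
From Stdlib Require Import Reals List Arith.
Import ListNotations.
Open Scope R_scope.

Inductive tree : Type := Node : list tree -> tree.

Fixpoint tsize (t : tree) : nat :=
  match t with Node f => S (list_sum (map tsize f)) end.

Fixpoint height (t : tree) : nat :=
  match t with
  | Node f => fold_right (fun c m => Nat.max (S (height c)) m) 0%nat f
  end.

Fixpoint gen (k : nat) (t : tree) : nat :=
  match k, t with
  | O, _ => 1%nat
  | S k', Node f => list_sum (map (gen k') f)
  end.

(** Width: largest size of a generation (generations k >= |t| are empty). *)
Definition width (t : tree) : nat :=
  fold_right Nat.max 0%nat (map (fun k => gen k t) (seq 0 (tsize t))).

(** Bienaymé weight P(T = t) = prod_{u in t} mu_{k_u(t)}. *)
Fixpoint weight (mu : nat -> R) (t : tree) : R :=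
  match t with
  | Node f => mu (length f) * fold_right (fun c r => weight mu c * r) 1 f
  end.

(** Enumeration of all plane forests (ordered lists of trees) with n vertices
    in total; fuel >= n suffices. *)
Fixpoint forests_fuel (fuel n : nat) : list (list tree) :=
  match fuel with
  | O => match n with O => [ [] ] | S _ => [] end
  | S fuel' =>
      match n with
      | O => [ [] ]
      | S _ =>
        flat_map (fun k =>
          flat_map (fun f =>
            map (fun g => Node f :: g) (forests_fuel fuel' (n - S k)))
            (forests_fuel fuel' k))
          (seq 0 n)
      end
  end.

Definition forests_of_size (n : nat) : list (list tree) := forests_fuel n n.

(** All plane trees with exactly n vertices (each listed once). *)
Definition trees_of_size (n : nat) : list tree :=
  match n with
  | O => []
  | S m => map Node (forests_of_size m)
  end.

Definition prob_size (mu : nat -> R) (n : nat) : R :=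
  fold_right Rplus 0 (map (weight mu) (trees_of_size n)).

Definition Pcond (mu : nat -> R) (n : nat) (A : tree -> bool) : R :=
  fold_right Rplus 0
    (map (fun t => if A t then weight mu t else 0) (trees_of_size n))
  / prob_size mu n.

Definition critical_offspring (mu : nat -> R) : Prop :=
  (forall k, 0 <= mu k) /\
  infinite_sum mu 1 /\
  infinite_sum (fun k => INR k * mu k) 1.

(* Main.v *)
(** Write a_n = P(|T| = n) and let A(z) = sum a_n z^n, so that A = z G(A) with G the
    generating function of mu.

    Criticality gives G(y) >= y, so A(z) = oo for all z > 1; since grafting trees at leaves
    makes (a_n) essentially supermultiplicative, a_n = exp(-o(n)) along admissible n.  Hence
    events of probability exp(-cn) are negligible under the conditioning.

    Width: the process x^|T| s^(-Z_k), for suitable x, s < 1, has mean at most 1 in every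
    generation k, so that Z_k > delta n has probability exp(-cn).

    Height: up to an event of probability exp(-cn), the empirical degree law nu of T_n has
    truncated mean at least 1 - eps.  Given its degrees, T_n is uniform, hence is a
    nu-Bienaymé tree conditioned on its degrees.  There are O(sqrt n) distinct degrees, so
    this conditioning costs only exp(O(sqrt n ln n)), whereas a nu-Bienaymé tree has size n
    and height at most M ln n with probability at most exp(-c n^(3/4)), because one
    generation multiplies the survival probability by at least 1 - 3 eps. *)

Require Import Defs.
From Stdlib Require Import Reals List ZArith Lia Lra Permutation.
From Stdlib Require Import ClassicalEpsilon.
Import ListNotations.
Open Scope R_scope.

(** * Real inequalities *)

Lemma INR_ge_1 n : (1 <= n)%nat -> 1 <= INR n.
Proof. apply (le_INR 1). Qed.

Lemma exp_le_compat x y : x <= y -> exp x <= exp y.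
Proof. intros [Hlt| ->]; [left; now apply exp_increasing|apply Rle_refl]. Qed.

Lemma exp_pow x k : exp x ^ k = exp (INR k * x).
Proof. rewrite <- Rpower_pow by apply exp_pos. unfold Rpower. now rewrite ln_exp. Qed.

Lemma exp_opp_le_1 x : 0 <= x -> exp (- x) <= 1.
Proof. intros Hx. rewrite <- exp_0. apply exp_le_compat. lra. Qed.

Lemma exp_opp_le_quadratic y : 0 <= y -> exp (- y) <= 1 - y + y * y.
Proof.
  intros Hy. rewrite exp_Ropp. pose proof (exp_ineq1_le y) as Hexp.
  apply (Rmult_le_reg_r (exp y)); [apply exp_pos|].
  rewrite Rinv_l by (pose proof (exp_pos y); lra).
  transitivity ((1 - y + y * y) * (1 + y)); [nra|]. apply Rmult_le_compat_l; nra.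
Qed.

Lemma bernoulli_inequality (y : R) k : 0 <= y -> 1 + INR k * (y - 1) <= y ^ k.
Proof.
  intros Hy. induction k as [|k IH]; [simpl; lra|].
  rewrite S_INR. cbn [pow]. pose proof (pos_INR k).
  assert (y * (1 + INR k * (y - 1)) <= y * y ^ k) by (apply Rmult_le_compat_l; auto).
  pose proof (Rle_0_sqr (y - 1)). unfold Rsqr in *. nra.
Qed.

Lemma succ_pow_le n : (INR n + 1) ^ n <= INR n ^ n * exp 1.
Proof.
  destruct n as [|n]; [simpl; pose proof (exp_ineq1_le 1); lra|]. set (m := S n).
  assert (Hm : 0 < INR m) by (apply lt_0_INR; unfold m; lia).
  transitivity ((INR m * exp (/ INR m)) ^ m).
  - apply pow_incr. split; [lra|].
    pose proof (Rmult_le_compat_l (INR m) _ _ ltac:(lra) (exp_ineq1_le (/ INR m))) as Hexp.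
    rewrite Rmult_plus_distr_l, Rinv_r in Hexp; lra.
  - rewrite Rpow_mult_distr, exp_pow, Rinv_r by lra. lra.
Qed.

Lemma pow_succ_ge n : exp 1 * INR n ^ S n <= (INR n + 1) ^ S n.
Proof.
  pose proof (pos_INR n) as Hn.
  transitivity (exp 1 * ((INR n + 1) * exp (- / (INR n + 1))) ^ S n).
  - apply Rmult_le_compat_l; [left; apply exp_pos|]. apply pow_incr. split; [assumption|].
    pose proof (Rmult_le_compat_l (INR n + 1) _ _ ltac:(lra)
      (exp_ineq1_le (- / (INR n + 1)))) as Hexp.
    rewrite Rmult_plus_distr_l, <- Ropp_mult_distr_r, Rinv_r in Hexp; lra.
  - rewrite Rpow_mult_distr, exp_pow, S_INR.
    replace ((INR n + 1) * - / (INR n + 1)) with (- (1)) by (field; lra).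
    rewrite (Rmult_comm (_ ^ _)), <- Rmult_assoc, <- exp_plus, Rplus_opp_r, exp_0. lra.
Qed.

Lemma pow_le_fact_exp n : INR n ^ n <= INR (fact n) * exp (INR n).
Proof.
  induction n as [|n IH]; [simpl; rewrite exp_0; lra|].
  rewrite fact_simpl, mult_INR, S_INR, exp_plus. cbn [pow].
  pose proof (pos_INR n). pose proof (exp_pos 1). pose proof (succ_pow_le n).
  transitivity ((INR n + 1) * (INR n ^ n * exp 1)).
  - apply Rmult_le_compat_l; lra.
  - rewrite !Rmult_assoc. apply Rmult_le_compat_l; [lra|]. rewrite <- Rmult_assoc.
    apply Rmult_le_compat_r; lra.
Qed.

Lemma fact_exp_le n :
  INR (fact (S n)) * exp (INR (S n)) <= exp 1 * INR (S n) * INR (S n) ^ S n.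
Proof.
  induction n as [|n IH]; [simpl; lra|].
  rewrite fact_simpl, mult_INR, (S_INR (S n)), exp_plus.
  set (m := S n) in *. pose proof (pos_INR m). pose proof (exp_pos 1).
  pose proof (pow_succ_ge m) as Hpow.
  transitivity ((INR m + 1) * exp 1 * (exp 1 * INR m * INR m ^ m)).
  - replace ((INR m + 1) * INR (fact m) * (exp (INR m) * exp 1))
      with ((INR m + 1) * exp 1 * (INR (fact m) * exp (INR m))) by ring.
    apply Rmult_le_compat_l; [nra|assumption].
  - rewrite (Rmult_comm (exp 1) (INR m + 1)). apply Rmult_le_compat_l; [nra|].
    cbn [pow] in *. lra.
Qed.

Lemma mul_exp_eventually_small c eps : 0 < c -> 0 < eps ->
  exists N, forall n, (N <= n)%nat -> INR n * exp (- (c * INR n)) < eps.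
Proof.
  intros Hc Heps. destruct (INR_unbounded (4 / (c * c * eps))) as [N HN].
  exists N. intros n Hn%le_INR.
  assert (Hcc : 0 < c * c * eps) by (repeat apply Rmult_lt_0_compat; assumption).
  assert (Hn4 : 4 < c * c * eps * INR n).
  { replace 4 with (c * c * eps * (4 / (c * c * eps))) by (field; split; lra).
    apply Rmult_lt_compat_l; lra. }
  (* [exp (c n) = exp (c n / 2)^2 >= (c n / 2)^2] *)
  assert (Hsq : c * INR n / 2 * (c * INR n / 2) <= exp (c * INR n)).
  { replace (c * INR n) with (c * INR n / 2 + c * INR n / 2) at 3 by field.
    rewrite exp_plus. pose proof (exp_ineq1_le (c * INR n / 2)).
    assert (0 < c * INR n) by nra. apply Rmult_le_compat; lra. }
  apply (Rmult_lt_reg_r (exp (c * INR n))); [apply exp_pos|].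
  rewrite Rmult_assoc, <- exp_plus, Rplus_opp_l, exp_0, Rmult_1_r.
  apply Rlt_le_trans with (eps * (c * INR n / 2 * (c * INR n / 2))); nra.
Qed.

Lemma ln_nonneg x : 1 <= x -> 0 <= ln x.
Proof.
  intros [Hx| <-]; [|rewrite ln_1; lra]. left. rewrite <- ln_1. apply ln_increasing; lra.
Qed.

Lemma exists_nat_ceil x : 0 <= x -> exists h, x < INR h <= x + 1.
Proof.
  intros Hx. destruct (archimed x) as [Hgt Hle]. exists (Z.to_nat (up x)).
  rewrite INR_IZR_INZ, Z2Nat.id; [lra|]. apply le_IZR. lra.
Qed.

Lemma Rpower_pos x a : 0 < Rpower x a.
Proof. apply exp_pos. Qed.

Lemma Rpower_ge_1 x a : 1 <= x -> 0 <= a -> 1 <= Rpower x a.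
Proof. intros Hx Ha. rewrite <- (Rpower_O x) by lra. apply Rle_Rpower; lra. Qed.

Lemma ln_le_Rpower x a : 0 < a -> 1 <= x -> a * ln x <= Rpower x a.
Proof.
  intros Ha Hx. pose proof (exp_ineq1_le (a * ln x)). unfold Rpower. lra.
Qed.

Lemma exp_pow_ceil_log_ge a M x h : 0 <= a -> INR h <= M * ln x + 1 ->
  exp (- a) * Rpower x (- (a * M)) <= exp (- a) ^ h.
Proof.
  intros Ha Hh. rewrite exp_pow. unfold Rpower. rewrite <- exp_plus.
  apply exp_le_compat. nra.
Qed.

Lemma Rpower_dominates a b c C C' : 0 <= b < a -> 0 < c ->
  exists N, forall n, (N <= n)%nat ->
    C * Rpower (INR n) b + C' <= c * Rpower (INR n) a.
Proof.
  intros Hab Hc. set (x := (Rabs C + Rabs C' + 1) / c).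
  pose proof (Rabs_pos C). pose proof (Rabs_pos C').
  assert (Hx : 0 < x) by (apply Rdiv_lt_0_compat; lra).
  destruct (INR_unbounded (Rpower x (/ (a - b)))) as [N HN]. exists (S N). intros n Hn.
  assert (Hn1 : 1 <= INR n) by (apply INR_ge_1; lia).
  assert (HNn : INR N <= INR n) by (apply le_INR; lia).
  assert (Hxn : x <= Rpower (INR n) (a - b)).
  { rewrite <- (Rpower_1 x), <- (Rinv_l (a - b)), <- Rpower_mult by lra.
    apply Rle_Rpower_l; [lra|]. split; [apply Rpower_pos|lra]. }
  apply (Rmult_le_compat_l c) in Hxn; [|lra].
  replace (c * x) with (Rabs C + Rabs C' + 1) in Hxn by (unfold x; field; lra).
  replace a with (b + (a - b)) by ring. rewrite Rpower_plus.
  pose proof (Rpower_ge_1 (INR n) b Hn1 (proj1 Hab)).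
  pose proof (Rle_abs C). pose proof (Rle_abs C'). nra.
Qed.

Definition Rleb (x y : R) : bool := if Rle_dec x y then true else false.

Definition Rltb (x y : R) : bool := if Rlt_dec x y then true else false.

Lemma Rleb_spec x y : BoolSpec (x <= y) (y < x) (Rleb x y).
Proof. unfold Rleb. destruct (Rle_dec x y); constructor; lra. Qed.

Lemma Rltb_spec x y : BoolSpec (x < y) (y <= x) (Rltb x y).
Proof. unfold Rltb. destruct (Rlt_dec x y); constructor; lra. Qed.

Definition ind (b : bool) : R := if b then 1 else 0.

Lemma ind_bounds b : 0 <= ind b <= 1.
Proof. destruct b; cbn; lra. Qed.

(** * Iterated sums and products over lists *)

Class CommutativeMonoid {M : Type} (op : M -> M -> M) (e : M) : Prop := {
  op_assoc : forall x y z, op x (op y z) = op (op x y) z;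
  op_comm : forall x y, op x y = op y x;
  op_unit_l : forall x, op e x = x
}.

#[local] Instance Rplus_monoid : CommutativeMonoid Rplus 0.
Proof. split; intros; ring. Qed.

#[local] Instance Rmult_monoid : CommutativeMonoid Rmult 1.
Proof. split; intros; ring. Qed.

Definition big {A M : Type} (op : M -> M -> M) (e : M) (f : A -> M) (l : list A) : M :=
  fold_right op e (map f l).

Notation lsum := (big Rplus 0).
Notation lprod := (big Rmult 1).

Lemma big_cons {A M} (op : M -> M -> M) e (f : A -> M) a l :
  big op e f (a :: l) = op (f a) (big op e f l).
Proof. reflexivity. Qed.

Lemma big_map {A B M} (op : M -> M -> M) e (f : B -> M) (h : A -> B) l :
  big op e f (map h l) = big op e (fun a => f (h a)) l.
Proof. unfold big. now rewrite map_map. Qed.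

Lemma big_ext_in {A M} (op : M -> M -> M) e (f g : A -> M) l :
  (forall a, In a l -> f a = g a) -> big op e f l = big op e g l.
Proof. intros Hfg. unfold big. f_equal. now apply map_ext_in. Qed.

Section BigOperators.

Context {M : Type} {op : M -> M -> M} {e : M} `{CommutativeMonoid M op e}.

Lemma op_swap x y z : op x (op y z) = op y (op x z).
Proof. rewrite !op_assoc. f_equal. apply op_comm. Qed.

Lemma big_app {A} (f : A -> M) l l' :
  big op e f (l ++ l') = op (big op e f l) (big op e f l').
Proof.
  induction l as [|a l IH]; cbn [app].
  - symmetry. apply op_unit_l.
  - rewrite !big_cons, IH. apply op_assoc.
Qed.

Lemma big_flat_map {A B} (f : B -> M) (h : A -> list B) l :
  big op e f (flat_map h l) = big op e (fun a => big op e f (h a)) l.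
Proof.
  induction l as [|a l IH]; [reflexivity|].
  cbn [flat_map]. now rewrite big_app, big_cons, IH.
Qed.

Lemma big_unit {A} (l : list A) : big op e (fun _ => e) l = e.
Proof. induction l as [|a l IH]; [reflexivity|]. now rewrite big_cons, IH, op_unit_l. Qed.

Lemma big_op {A} (f g : A -> M) l :
  big op e (fun a => op (f a) (g a)) l = op (big op e f l) (big op e g l).
Proof.
  induction l as [|a l IH].
  - symmetry. apply op_unit_l.
  - rewrite !big_cons, IH, <- !op_assoc. f_equal. apply op_swap.
Qed.

Lemma big_exchange {A B} (f : A -> B -> M) l l' :
  big op e (fun a => big op e (f a) l') l = big op e (fun b => big op e (fun a => f a b) l) l'.
Proof.
  induction l as [|a l IH].
  - symmetry. apply big_unit.
  - rewrite big_cons, IH, <- big_op. now apply big_ext_in.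
Qed.

Lemma big_perm {A} (f : A -> M) l l' : Permutation l l' -> big op e f l = big op e f l'.
Proof.
  induction 1; rewrite ?big_cons in *; auto using op_swap; congruence.
Qed.

Lemma big_update {A} (f g : A -> M) l k x : NoDup l -> In k l ->
  f k = op x (g k) -> (forall i, i <> k -> f i = g i) -> big op e f l = op x (big op e g l).
Proof.
  intros Hl Hk Hfk Hfg. apply in_split in Hk as (l1 & l2 & ->).
  pose proof (NoDup_remove_2 _ _ _ Hl) as Hnotin.
  rewrite <- !(big_perm _ _ _ (Permutation_middle l1 l2 k)), !big_cons, Hfk, <- op_assoc.
  do 2 f_equal. apply big_ext_in. intros i Hi. apply Hfg. now intros ->.
Qed.

Lemma big_count_occ {A} (eq_dec : forall x y : A, {x = y} + {x <> y}) (f : A -> M) w l :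
  NoDup l -> (forall a, In a w -> ~ In a l -> f a = e) ->
  big op e (fun k => Nat.iter (count_occ eq_dec w k) (op (f k)) e) l = big op e f w.
Proof.
  intros Hl. induction w as [|a w IH]; intros Hout; [apply big_unit|].
  rewrite big_cons, <- IH by (intros; apply Hout; simpl; auto).
  destruct (in_dec eq_dec a l) as [Ha|Ha].
  - apply (big_update _ _ _ a); auto.
    + now rewrite count_occ_cons_eq.
    + intros i Hi. now rewrite count_occ_cons_neq by congruence.
  - rewrite (Hout a), op_unit_l by (simpl; auto). apply big_ext_in. intros k Hk.
    rewrite count_occ_cons_neq by congruence. reflexivity.
Qed.

End BigOperators.

Lemma lsum_le_in {A} (f g : A -> R) l :
  (forall a, In a l -> f a <= g a) -> lsum f l <= lsum g l.
Proof.
  induction l as [|a l IH]; intros Hfg; [apply Rle_refl|].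
  rewrite !big_cons. apply Rplus_le_compat; [apply Hfg; now left|].
  apply IH; intros; apply Hfg; now right.
Qed.

Lemma lsum_const {A} (c : R) (l : list A) : lsum (fun _ => c) l = INR (length l) * c.
Proof.
  induction l as [|a l IH]; [cbn; ring|].
  rewrite big_cons, IH. cbn [length]. rewrite S_INR. ring.
Qed.

Lemma lsum_nonneg {A} (f : A -> R) l : (forall a, In a l -> 0 <= f a) -> 0 <= lsum f l.
Proof.
  intros Hf. transitivity (lsum (fun _ => 0) l); [right; symmetry; apply big_unit|].
  now apply lsum_le_in.
Qed.

Lemma lsum_scal {A} (c : R) (f : A -> R) l : lsum (fun a => c * f a) l = c * lsum f l.
Proof. induction l as [|a l IH]; [cbn; ring|]. rewrite !big_cons, IH. ring. Qed.

Lemma lsum_scal_r {A} (c : R) (f : A -> R) l : lsum (fun a => f a * c) l = lsum f l * c.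
Proof. rewrite Rmult_comm, <- lsum_scal. apply big_ext_in. intros; ring. Qed.

Lemma lsum_incl {A} (f : A -> R) l l' :
  NoDup l -> incl l l' -> (forall a, In a l' -> 0 <= f a) -> lsum f l <= lsum f l'.
Proof.
  revert l'. induction l as [|a l IH]; intros l' Hl Hincl Hpos; [now apply lsum_nonneg|].
  inversion Hl as [|? ? Ha Hl']; subst.
  destruct (in_split a l' (Hincl a (or_introl eq_refl))) as (l1 & l2 & ->).
  rewrite <- (big_perm f _ _ (Permutation_middle l1 l2 a)), !big_cons.
  apply Rplus_le_compat_l, IH; auto.
  - intros b Hb. pose proof (Hincl b (or_intror Hb)) as Hin.
    rewrite in_app_iff in *. destruct Hin as [|[->|]]; tauto.
  - intros b Hb. apply Hpos. rewrite in_app_iff in *. simpl. tauto.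
Qed.

Lemma lsum_ge_term {A} (f : A -> R) l a :
  In a l -> (forall b, In b l -> 0 <= f b) -> f a <= lsum f l.
Proof.
  intros Ha Hpos. replace (f a) with (lsum f [a]) by (cbn; ring).
  apply lsum_incl; auto.
  - repeat constructor. intros [].
  - intros b [->|[]]; assumption.
Qed.

Lemma INR_length {A} (l : list A) : INR (length l) = lsum (fun _ => 1) l.
Proof. rewrite lsum_const. ring. Qed.

Lemma INR_list_sum w : INR (list_sum w) = lsum INR w.
Proof.
  induction w as [|a w IH]; [reflexivity|]. rewrite big_cons, <- IH, <- plus_INR. reflexivity.
Qed.

Lemma lsum_count_occ (f : nat -> R) w l :
  NoDup l -> (forall a, In a w -> ~ In a l -> f a = 0) ->
  lsum (fun k => INR (count_occ Nat.eq_dec w k) * f k) l = lsum f w.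
Proof.
  intros Hl Hout. rewrite <- (big_count_occ Nat.eq_dec f w l Hl Hout).
  apply big_ext_in. intros k _. generalize (count_occ Nat.eq_dec w k). intros n.
  induction n as [|n IH]; [cbn; ring|]. rewrite S_INR, Nat.iter_succ, <- IH. ring.
Qed.

Lemma lprod_nonneg {A} (f : A -> R) l : (forall a, In a l -> 0 <= f a) -> 0 <= lprod f l.
Proof.
  induction l as [|a l IH]; intros Hf; [cbn; lra|].
  rewrite big_cons. apply Rmult_le_pos; [apply Hf; now left|].
  apply IH; intros; apply Hf; now right.
Qed.

Lemma lprod_le_in {A} (f g : A -> R) l :
  (forall a, In a l -> 0 <= f a <= g a) -> lprod f l <= lprod g l.
Proof.
  induction l as [|a l IH]; intros Hfg; [apply Rle_refl|].
  rewrite !big_cons. apply Rmult_le_compat.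
  - apply Hfg; now left.
  - apply lprod_nonneg; intros b Hb; apply Hfg; now right.
  - apply Hfg; now left.
  - apply IH; intros; apply Hfg; now right.
Qed.

Lemma lprod_const {A} (c : R) (l : list A) : lprod (fun _ => c) l = c ^ length l.
Proof. induction l as [|a l IH]; [reflexivity|]. now rewrite big_cons, IH. Qed.

Lemma lprod_exp {A} (f : A -> R) l : lprod (fun a => exp (f a)) l = exp (lsum f l).
Proof.
  induction l as [|a l IH]; [symmetry; apply exp_0|]. now rewrite !big_cons, IH, exp_plus.
Qed.

Lemma lprod_pow {A} (c : R) (h : A -> nat) l :
  lprod (fun a => c ^ h a) l = c ^ list_sum (map h l).
Proof.
  induction l as [|a l IH]; [reflexivity|]. rewrite big_cons, IH, <- pow_add. reflexivity.
Qed.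

Lemma lprod_count_occ (f : nat -> R) w l :
  NoDup l -> incl w l -> lprod (fun k => f k ^ count_occ Nat.eq_dec w k) l = lprod f w.
Proof.
  intros Hl Hincl. rewrite <- (big_count_occ Nat.eq_dec f w l Hl).
  - apply big_ext_in. intros k _. generalize (count_occ Nat.eq_dec w k). intros n.
    induction n as [|n IH]; [reflexivity|]. cbn [pow]. now rewrite IH.
  - intros a Ha Hout. now apply Hincl in Ha.
Qed.

Lemma lsum_seq_S (f : nat -> R) n : lsum f (seq 0 (S n)) = lsum f (seq 0 n) + f n.
Proof. rewrite seq_S, big_app. cbn. ring. Qed.

Lemma lsum_seq_sum_f_R0 f n : lsum f (seq 0 (S n)) = sum_f_R0 f n.
Proof.
  induction n as [|n IH]; [cbn; ring|]. now rewrite lsum_seq_S, IH.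
Qed.

Lemma lsum_seq_mono (f : nat -> R) B B' :
  (forall k, 0 <= f k) -> (B <= B')%nat -> lsum f (seq 0 B) <= lsum f (seq 0 B').
Proof.
  intros Hf HB. apply lsum_incl; auto using seq_NoDup.
  intros k Hk. apply in_seq in Hk. apply in_seq. lia.
Qed.

Lemma infinite_sum_partial_le f l B :
  (forall k, 0 <= f k) -> infinite_sum f l -> lsum f (seq 0 B) <= l.
Proof.
  intros Hf Hl. eapply Rle_trans; [apply (lsum_seq_mono f B (S B)); auto|].
  rewrite lsum_seq_sum_f_R0. now apply sum_incr.
Qed.

Lemma infinite_sum_partial_ge f l eps :
  (forall k, 0 <= f k) -> infinite_sum f l -> 0 < eps ->
  exists K, forall B, (K <= B)%nat -> l - eps <= lsum f (seq 0 B).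
Proof.
  intros Hf Hl Heps. destruct (Hl eps Heps) as [N HN]. exists (S N). intros B HB.
  specialize (HN N (le_n N)). apply Rabs_def2 in HN. rewrite <- lsum_seq_sum_f_R0 in HN.
  pose proof (lsum_seq_mono f _ _ Hf HB). lra.
Qed.

Lemma lsum_geom_le r N : 0 <= r < 1 -> lsum (fun n => r ^ n) (seq 0 N) <= / (1 - r).
Proof.
  intros Hr. assert (Hpow : forall n, 0 <= r ^ n) by (intros; apply pow_le; lra).
  eapply Rle_trans; [apply (lsum_seq_mono _ N (S N)); auto|].
  rewrite lsum_seq_sum_f_R0, tech3 by lra. rewrite <- (Rmult_1_l (/ (1 - r))).
  apply Rmult_le_compat_r; [left; apply Rinv_0_lt_compat; lra|].
  specialize (Hpow (S N)). lra.
Qed.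

Lemma NoDup_flat_map {A B} (h : A -> list B) l :
  NoDup l -> (forall a, In a l -> NoDup (h a)) ->
  (forall a b x, In a l -> In b l -> In x (h a) -> In x (h b) -> a = b) ->
  NoDup (flat_map h l).
Proof.
  induction l as [|a l IH]; intros Hl Hh Hdisj; [constructor|].
  inversion Hl; subst. cbn [flat_map]. apply NoDup_app.
  - apply Hh; now left.
  - apply IH; auto.
    + intros; apply Hh; now right.
    + intros b c x Hb Hc; apply Hdisj; now right.
  - intros x Hx Hin. apply in_flat_map in Hin as (b & Hb & Hxb).
    assert (a = b) by (apply (Hdisj a b x); simpl; auto). now subst.
Qed.

Fixpoint remove_one (k : nat) (w : list nat) : list nat :=
  match w with
  | [] => []
  | a :: w' => if Nat.eq_dec a k then w' else a :: remove_one k w'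
  end.

Lemma remove_one_perm k w : In k w -> Permutation w (k :: remove_one k w).
Proof.
  induction w as [|a w IH]; intros Hk; [destruct Hk|]. cbn [remove_one].
  destruct (Nat.eq_dec a k) as [->|Hak]; [reflexivity|].
  destruct Hk as [->|Hk]; [contradiction|]. rewrite (IH Hk) at 1. constructor.
Qed.

Lemma list_sum_perm w w' : Permutation w w' -> list_sum w = list_sum w'.
Proof. intros Hw. apply INR_eq. rewrite !INR_list_sum. now apply big_perm. Qed.

Lemma remove_one_size k w : In k w ->
  length w = S (length (remove_one k w)) /\ list_sum w = (k + list_sum (remove_one k w))%nat.
Proof.
  intros Hk%remove_one_perm. split.
  - now rewrite (Permutation_length Hk) at 1.
  - now rewrite (list_sum_perm _ _ Hk) at 1.
Qed.

Lemma NoDup_list_sum_ge l : NoDup l -> (length l * length l <= 2 * list_sum l + length l)%nat.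
Proof.
  enough (Hbound : forall B l, NoDup l -> incl l (seq 0 B) ->
    (length l * length l <= 2 * list_sum l + length l)%nat).
  { intros Hl. apply (Hbound (S (list_max l))); [assumption|].
    intros a Ha. apply in_seq. pose proof (proj1 (list_max_le l _) (le_n _)) as Hmax.
    rewrite Forall_forall in Hmax. specialize (Hmax a Ha). lia. }
  clear l. induction B as [|B IH]; intros l Hl Hincl.
  { now rewrite (incl_l_nil Hincl). }
  rewrite seq_S in Hincl. destruct (in_dec Nat.eq_dec B l) as [HB|HB].
  - pose proof (NoDup_incl_length Hl Hincl) as Hlen. rewrite length_app, length_seq in Hlen.
    pose proof (remove_one_perm B l HB) as Hperm. destruct (remove_one_size B l HB) as [Hlen' Hsum].
    apply (Permutation_NoDup Hperm), NoDup_cons_iff in Hl as [HnotB Hl'].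
    specialize (IH (remove_one B l) Hl'). cbn [length] in *.
    enough (incl (remove_one B l) (seq 0 B)) by (specialize (IH ltac:(assumption)); nia).
    intros a Ha. assert (Hal : In a l).
    { apply (Permutation_in a (Permutation_sym Hperm)). now right. }
    apply Hincl, in_app_iff in Hal as [|[<-|[]]]; [assumption|contradiction].
  - apply IH; [assumption|]. intros a Ha. apply Hincl in Ha as Ha'.
    apply in_app_iff in Ha' as [|[<-|[]]]; [assumption|contradiction].
Qed.

Lemma list_sum_nodup_le w : (list_sum (nodup Nat.eq_dec w) <= list_sum w)%nat.
Proof.
  induction w as [|a w IH]; [apply le_n|]. cbn [nodup].
  destruct (in_dec Nat.eq_dec a w); cbn [list_sum fold_right] in *; fold (list_sum w) in *;
    fold (list_sum (nodup Nat.eq_dec w)); lia.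
Qed.

Lemma count_distinct_sq_le w : let D := length (nodup Nat.eq_dec w) in
  (D * D <= 2 * list_sum w + D)%nat.
Proof.
  cbv zeta. pose proof (NoDup_list_sum_ge _ (NoDup_nodup Nat.eq_dec w)).
  pose proof (list_sum_nodup_le w). lia.
Qed.

Lemma list_max_cases l : list_max l = 0%nat \/ In (list_max l) l.
Proof.
  induction l as [|a l IH]; [now left|]. right. cbn [list_max fold_right].
  fold (list_max l). destruct (Nat.max_spec a (list_max l)) as [[Hlt ->]|[_ ->]]; [|now left].
  right. destruct IH as [Hzero|]; [lia|assumption].
Qed.

Lemma INR_length_filter {A} (p : A -> bool) l :
  INR (length (filter p l)) = lsum (fun a => ind (p a)) l.
Proof.
  induction l as [|a l IH]; [reflexivity|]. rewrite big_cons. cbn [filter].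
  destruct (p a); cbn [length ind]; rewrite ?S_INR, IH; ring.
Qed.

(** * Plane trees and their enumeration *)

Lemma tree_ind_children (P : tree -> Prop) :
  (forall f, (forall c, In c f -> P c) -> P (Node f)) -> forall t, P t.
Proof.
  intros Hnode. fix IH 1. intros [f]. apply Hnode.
  induction f as [|c f IHf]; [intros _ []|].
  intros d [<-|Hd]; [apply IH|now apply IHf].
Qed.

Lemma forest_ind (P : list tree -> Prop) :
  P [] -> (forall g f, P g -> P f -> P (Node g :: f)) -> forall f, P f.
Proof.
  intros Hnil Hcons.
  assert (Hchildren : forall t, match t with Node g => P g end).
  { intros t. induction t as [g IH] using tree_ind_children.
    induction g as [|[g'] g IHg]; [assumption|].
    apply Hcons; [exact (IH (Node g') (or_introl eq_refl))|].
    apply IHg. intros c Hc. apply IH. now right. }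
  intros f. exact (Hchildren (Node f)).
Qed.

Lemma leftmost_ind (P : tree -> Prop) :
  P (Node []) -> (forall c f, P c -> P (Node (c :: f))) -> forall t, P t.
Proof.
  intros Hleaf Hstep t. induction t as [[|c f] IH] using tree_ind_children; [assumption|].
  apply Hstep, IH. now left.
Qed.

Definition fsize (f : list tree) : nat := list_sum (map tsize f).

Lemma fsize_cons c f : fsize (c :: f) = (tsize c + fsize f)%nat.
Proof. reflexivity. Qed.

Lemma tsize_Node f : tsize (Node f) = S (fsize f).
Proof. reflexivity. Qed.

Lemma tsize_pos t : (1 <= tsize t)%nat.
Proof. destruct t. rewrite tsize_Node. lia. Qed.

Lemma fsize_0 f : fsize f = 0%nat <-> f = [].
Proof.
  split; [|now intros ->]. destruct f as [|c f]; [reflexivity|].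
  rewrite fsize_cons. pose proof (tsize_pos c). lia.
Qed.

Lemma length_le_fsize f : (length f <= fsize f)%nat.
Proof.
  induction f as [|c f IH]; [apply le_n|].
  rewrite fsize_cons. cbn [length]. pose proof (tsize_pos c). lia.
Qed.

Lemma tsize_le_fsize c f : In c f -> (tsize c <= fsize f)%nat.
Proof.
  induction f as [|d f IH]; [intros []|].
  rewrite fsize_cons. intros [->|Hc]; [lia|]. specialize (IH Hc). lia.
Qed.

Lemma fsize_le_mul N f :
  (forall c, In c f -> (tsize c <= N)%nat) -> (fsize f <= length f * N)%nat.
Proof.
  induction f as [|c f IH]; intros Hle; [apply le_n|].
  rewrite fsize_cons. cbn [length Nat.mul].
  apply Nat.add_le_mono; [apply Hle; now left|apply IH; intros; apply Hle; now right].
Qed.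

Lemma in_forests_fuel fuel n f : (n <= fuel)%nat ->
  In f (forests_fuel fuel n) <-> fsize f = n.
Proof.
  assert (Hnil : forall f, In f [[]] <-> fsize f = 0%nat).
  { intros g. rewrite fsize_0. simpl. intuition congruence. }
  revert n f. induction fuel as [|fuel IH]; intros [|n] f Hn; try apply Hnil; [lia|].
  cbn [forests_fuel]. rewrite in_flat_map. split.
  - intros (k & Hk%in_seq & (g & Hg & (g' & <- & Hg')%in_map_iff)%in_flat_map).
    apply IH in Hg; [|lia]. apply IH in Hg'; [|lia].
    rewrite fsize_cons, tsize_Node. lia.
  - intros Hf. destruct f as [|[g] g']; [discriminate|].
    rewrite fsize_cons, tsize_Node in Hf.
    exists (fsize g). split; [apply in_seq; lia|].
    apply in_flat_map. exists g. split; [apply IH; lia|].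
    apply (in_map (fun g' => Node g :: g')), IH; lia.
Qed.

Lemma NoDup_forests_fuel fuel n : (n <= fuel)%nat -> NoDup (forests_fuel fuel n).
Proof.
  revert n. induction fuel as [|fuel IH]; intros [|n] Hn;
    try (repeat constructor; simpl; tauto).
  cbn [forests_fuel]. apply NoDup_flat_map; [apply seq_NoDup| |].
  - intros k Hk%in_seq. apply NoDup_flat_map; [apply IH; lia| |].
    + intros g _. apply NoDup_map_NoDup_ForallPairs; [|apply IH; lia].
      intros g1 g2 _ _. congruence.
    + intros g1 g2 x _ _ (? & <- & _)%in_map_iff (? & Heq & _)%in_map_iff. congruence.
  - intros k1 k2 x Hk1%in_seq Hk2%in_seq.
    intros (g1 & Hg1 & (? & <- & _)%in_map_iff)%in_flat_map.
    intros (g2 & Hg2 & (? & Heq & _)%in_map_iff)%in_flat_map.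
    apply in_forests_fuel in Hg1; [|lia]. apply in_forests_fuel in Hg2; [|lia].
    congruence.
Qed.

Lemma in_forests_of_size n f : In f (forests_of_size n) <-> fsize f = n.
Proof. now apply in_forests_fuel. Qed.

Lemma NoDup_forests_of_size n : NoDup (forests_of_size n).
Proof. now apply NoDup_forests_fuel. Qed.

Lemma in_trees_of_size n t : In t (trees_of_size n) <-> tsize t = n.
Proof.
  destruct n as [|n].
  - pose proof (tsize_pos t). simpl. lia.
  - unfold trees_of_size. rewrite in_map_iff. split.
    + intros (f & <- & Hf%in_forests_of_size). now rewrite tsize_Node, Hf.
    + destruct t as [f]. rewrite tsize_Node. intros Hf. exists f.
      split; [reflexivity|]. apply in_forests_of_size. lia.
Qed.

Lemma NoDup_trees_of_size n : NoDup (trees_of_size n).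
Proof.
  destruct n as [|n]; [constructor|].
  apply NoDup_map_NoDup_ForallPairs, NoDup_forests_of_size. intros f g _ _. congruence.
Qed.

Definition trees_upto (N : nat) : list tree := flat_map trees_of_size (seq 0 (S N)).

Lemma in_trees_upto N t : In t (trees_upto N) <-> (tsize t <= N)%nat.
Proof.
  unfold trees_upto. rewrite in_flat_map. split.
  - intros (k & Hk%in_seq & Ht%in_trees_of_size). lia.
  - intros Ht. exists (tsize t). split; [apply in_seq; lia|]. now apply in_trees_of_size.
Qed.

Lemma NoDup_trees_upto N : NoDup (trees_upto N).
Proof.
  apply NoDup_flat_map; auto using seq_NoDup, NoDup_trees_of_size.
  intros a b t _ _ Ha%in_trees_of_size Hb%in_trees_of_size. congruence.
Qed.

Lemma lsum_trees_of_size_le (g : tree -> R) n :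
  (forall t, 0 <= g t) -> lsum g (trees_of_size n) <= lsum g (trees_upto n).
Proof.
  intros Hg. apply lsum_incl; auto using NoDup_trees_of_size.
  intros t Ht%in_trees_of_size. apply in_trees_upto. lia.
Qed.

Fixpoint tuples {A : Type} (k : nat) (L : list A) : list (list A) :=
  match k with
  | O => [[]]
  | S k' => flat_map (fun c => map (cons c) (tuples k' L)) L
  end.

Lemma in_tuples {A} k (L : list A) f : In f (tuples k L) <-> length f = k /\ incl f L.
Proof.
  revert f. induction k as [|k IH]; intros f; cbn [tuples].
  - split.
    + intros [<-|[]]. split; [reflexivity|]. intros _ [].
    + intros [Hlen _]. apply length_zero_iff_nil in Hlen as ->. now left.
  - rewrite in_flat_map. split.
    + intros (c & Hc & (g & <- & [Hlen Hincl]%IH)%in_map_iff).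
      split; [cbn; congruence|now apply incl_cons].
    + intros [Hlen Hincl]. destruct f as [|c f]; [discriminate|].
      apply incl_cons_inv in Hincl as [Hc Hincl]. exists c. split; [assumption|].
      apply in_map, IH. split; [now injection Hlen|assumption].
Qed.

Lemma NoDup_tuples {A} k (L : list A) : NoDup L -> NoDup (tuples k L).
Proof.
  intros HL. induction k as [|k IH]; cbn [tuples]; [repeat constructor; intros []|].
  apply NoDup_flat_map; auto.
  - intros c _. apply NoDup_map_NoDup_ForallPairs; [|assumption]. intros f g _ _. congruence.
  - intros c d x _ _ (? & <- & _)%in_map_iff (? & Heq & _)%in_map_iff. congruence.
Qed.

Lemma lsum_tuples {A} (g : A -> R) k L : lsum (lprod g) (tuples k L) = lsum g L ^ k.
Proof.
  induction k as [|k IH]; cbn [tuples pow]; [cbn; ring|].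
  rewrite big_flat_map, <- lsum_scal_r. apply big_ext_in. intros c _.
  rewrite big_map, <- IH, <- lsum_scal. reflexivity.
Qed.

(** * Branching sums *)

Definition nodes (B : nat) (L : list tree) : list tree :=
  map Node (flat_map (fun k => tuples k L) (seq 0 B)).

Lemma in_nodes B L f : In (Node f) (nodes B L) <-> (length f < B)%nat /\ incl f L.
Proof.
  unfold nodes. rewrite in_map_iff. split.
  - intros (f' & [= ->] & (k & Hk%in_seq & [<- Hincl]%in_tuples)%in_flat_map).
    split; [lia|assumption].
  - intros [Hlen Hincl]. exists f. split; [reflexivity|]. apply in_flat_map.
    exists (length f). split; [apply in_seq; lia|]. now apply in_tuples.
Qed.

Lemma NoDup_nodes B L : NoDup L -> NoDup (nodes B L).
Proof.
  intros HL. apply NoDup_map_NoDup_ForallPairs; [intros f g _ _; congruence|].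
  apply NoDup_flat_map; auto using seq_NoDup, NoDup_tuples.
  intros a b f _ _ [Ha _]%in_tuples [Hb _]%in_tuples. congruence.
Qed.

Section Branching.

Variables (v : nat -> R) (g g' : tree -> R).
Hypothesis v_nonneg : forall k, 0 <= v k.
Hypothesis g'_nonneg : forall t, 0 <= g' t.
Hypothesis g_Node : forall f, g (Node f) = v (length f) * lprod g' f.

Lemma lsum_nodes B L :
  lsum g (nodes B L) = lsum (fun k => v k * lsum g' L ^ k) (seq 0 B).
Proof.
  unfold nodes. rewrite big_map, big_flat_map. apply big_ext_in. intros k _.
  rewrite <- lsum_tuples, <- lsum_scal. apply big_ext_in. intros f [<- _]%in_tuples.
  apply g_Node.
Qed.

Lemma branching_nonneg t : 0 <= g t.
Proof.
  destruct t as [f]. rewrite g_Node. apply Rmult_le_pos; auto using lprod_nonneg.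
Qed.

Lemma branching_sum_le N :
  lsum g (trees_upto (S N)) <=
  lsum (fun k => v k * lsum g' (trees_upto N) ^ k) (seq 0 (S N)).
Proof.
  rewrite <- lsum_nodes. apply lsum_incl; auto using NoDup_trees_upto, branching_nonneg.
  intros [f] Hf%in_trees_upto. rewrite tsize_Node in Hf. apply in_nodes. split.
  - pose proof (length_le_fsize f). lia.
  - intros c Hc%tsize_le_fsize. apply in_trees_upto. lia.
Qed.

Lemma branching_sum_ge N B :
  lsum (fun k => v k * lsum g' (trees_upto N) ^ k) (seq 0 B) <=
  lsum g (trees_upto (S (B * N))).
Proof.
  rewrite <- lsum_nodes.
  apply lsum_incl; auto using branching_nonneg, NoDup_nodes, NoDup_trees_upto.
  intros [f] [Hlen Hincl]%in_nodes. apply in_trees_upto. rewrite tsize_Node.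
  apply le_n_S. transitivity (length f * N)%nat; [|apply Nat.mul_le_mono_r; lia].
  apply fsize_le_mul. intros c Hc. now apply in_trees_upto, Hincl.
Qed.

Lemma branching_sum_bound y y' N :
  lsum g' (trees_upto N) <= y ->
  (forall B, lsum (fun k => v k * y ^ k) (seq 0 B) <= y') ->
  lsum g (trees_upto (S N)) <= y'.
Proof.
  intros Hy Hy'. eapply Rle_trans; [apply branching_sum_le|].
  eapply Rle_trans; [|apply (Hy' (S N))]. apply lsum_le_in. intros k _.
  apply Rmult_le_compat_l; [apply v_nonneg|]. apply pow_incr.
  split; [now apply lsum_nonneg|exact Hy].
Qed.

End Branching.

Lemma weight_Node mu f : weight mu (Node f) = mu (length f) * lprod (weight mu) f.
Proof. cbn [weight]. f_equal. induction f as [|c f IH]; [reflexivity|]. cbn. now rewrite IH. Qed.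

Lemma weight_nonneg mu t : (forall k, 0 <= mu k) -> 0 <= weight mu t.
Proof.
  intros Hmu. induction t as [f IH] using tree_ind_children. rewrite weight_Node.
  apply Rmult_le_pos; auto using lprod_nonneg.
Qed.

Fixpoint degs (t : tree) : list nat :=
  match t with Node f => length f :: flat_map degs f end.

Definition fdegs (f : list tree) : list nat := flat_map degs f.

Lemma degs_Node f : degs (Node f) = length f :: fdegs f.
Proof. reflexivity. Qed.

Lemma fdegs_Node_cons g f : fdegs (Node g :: f) = length g :: fdegs g ++ fdegs f.
Proof. reflexivity. Qed.

Lemma lprod_weight mu f : lprod (weight mu) f = lprod mu (fdegs f).
Proof.
  induction f as [|g f IHg IHf] using forest_ind; [reflexivity|].
  rewrite fdegs_Node_cons, !big_cons, big_app, weight_Node, IHg, IHf. ring.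
Qed.

Lemma weight_degs mu t : weight mu t = lprod mu (degs t).
Proof. destruct t as [f]. now rewrite weight_Node, degs_Node, big_cons, lprod_weight. Qed.

Lemma length_fdegs f : length (fdegs f) = fsize f.
Proof.
  induction f as [|g f IHg IHf] using forest_ind; [reflexivity|].
  rewrite fdegs_Node_cons, fsize_cons, tsize_Node. cbn [length]. rewrite length_app. lia.
Qed.

Lemma length_degs t : length (degs t) = tsize t.
Proof.
  destruct t as [f]. rewrite degs_Node, tsize_Node. cbn [length]. now rewrite length_fdegs.
Qed.

Lemma sum_fdegs f : (length f + list_sum (fdegs f))%nat = fsize f.
Proof.
  induction f as [|g f IHg IHf] using forest_ind; [reflexivity|].
  rewrite fdegs_Node_cons, fsize_cons, tsize_Node. cbn [length list_sum fold_right].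
  fold (list_sum (fdegs g ++ fdegs f)). rewrite list_sum_app. lia.
Qed.

Lemma sum_degs t : S (list_sum (degs t)) = tsize t.
Proof. destruct t as [f]. rewrite degs_Node, tsize_Node. cbn. f_equal. apply sum_fdegs. Qed.

Lemma weight_scal x mu t : weight (fun k => x * mu k) t = x ^ tsize t * weight mu t.
Proof. now rewrite !weight_degs, big_op, lprod_const, length_degs. Qed.

(** * Subexponential lower bound on the size distribution *)

Fixpoint graft (t s : tree) : tree :=
  match t with
  | Node [] => s
  | Node (c :: f) => Node (graft c s :: f)
  end.

Lemma tsize_graft t s : S (tsize (graft t s)) = (tsize t + tsize s)%nat.
Proof.
  induction t as [|c f IH] using leftmost_ind; [reflexivity|].
  cbn [graft]. rewrite !tsize_Node, !fsize_cons. lia.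
Qed.

Lemma weight_graft mu t s : mu 0%nat * weight mu (graft t s) = weight mu t * weight mu s.
Proof.
  induction t as [|c f IH] using leftmost_ind; cbn [graft].
  - rewrite weight_Node. cbn. ring.
  - rewrite !weight_Node, !big_cons. cbn [length].
    transitivity (mu (S (length f)) * lprod (weight mu) f * (mu 0%nat * weight mu (graft c s)));
      [ring|rewrite IH; ring].
Qed.

Lemma tsize_graft_cons c f s : (tsize s < tsize (graft (Node (c :: f)) s))%nat.
Proof.
  pose proof (tsize_graft (Node (c :: f)) s). pose proof (tsize_pos c).
  rewrite (tsize_Node (c :: f)), fsize_cons in *. lia.
Qed.

Lemma graft_inj t s t' s' :
  tsize s = tsize s' -> graft t s = graft t' s' -> t = t' /\ s = s'.
Proof.
  intros Hs. revert t'. induction t as [|c f IH] using leftmost_ind; intros [[|c' f']] Heq.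
  - auto.
  - pose proof (tsize_graft_cons c' f' s'). rewrite <- Heq in *. cbn [graft] in *. lia.
  - pose proof (tsize_graft_cons c f s). rewrite Heq in *. cbn [graft] in *. lia.
  - cbn [graft] in Heq. injection Heq as Heq <-. apply IH in Heq as [<- <-]. auto.
Qed.

Lemma prob_size_1 mu : prob_size mu 1 = mu 0%nat.
Proof. unfold prob_size. cbn. ring. Qed.

Lemma prob_size_lsum mu n : prob_size mu n = lsum (weight mu) (trees_of_size n).
Proof. reflexivity. Qed.

Lemma prob_size_no_leaf mu n : mu 0%nat = 0 -> prob_size mu n = 0.
Proof.
  intros Hmu. rewrite prob_size_lsum.
  transitivity (lsum (fun _ => 0) (trees_of_size n)); [|apply big_unit].
  apply big_ext_in. intros t _. induction t as [|c f IH] using leftmost_ind; rewrite weight_Node.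
  - cbn [length]. rewrite Hmu. ring.
  - rewrite big_cons, IH. ring.
Qed.

Lemma prob_size_supermult mu n m : (forall k, 0 <= mu k) ->
  prob_size mu (S n) * prob_size mu (S m) <= mu 0%nat * prob_size mu (S (n + m)).
Proof.
  intros Hmu. rewrite !prob_size_lsum.
  set (grafts := flat_map (fun t => map (graft t) (trees_of_size (S m))) (trees_of_size (S n))).
  transitivity (lsum (fun t => mu 0%nat * weight mu t) grafts).
  - right. unfold grafts. rewrite big_flat_map, <- lsum_scal_r. apply big_ext_in.
    intros t _. rewrite big_map, <- lsum_scal. apply big_ext_in.
    intros s _. symmetry; apply weight_graft.
  - rewrite lsum_scal. apply Rmult_le_compat_l; [auto|].
    apply lsum_incl; auto using weight_nonneg.
    + apply NoDup_flat_map; [apply NoDup_trees_of_size| |].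
      * intros t _. apply NoDup_map_NoDup_ForallPairs; [|apply NoDup_trees_of_size].
        intros s s' Hs%in_trees_of_size Hs'%in_trees_of_size Heq.
        apply graft_inj in Heq; [tauto|congruence].
      * intros t t' x _ _ (s & <- & Hs%in_trees_of_size)%in_map_iff.
        intros (s' & Heq & Hs'%in_trees_of_size)%in_map_iff.
        apply graft_inj in Heq; [symmetry; tauto|congruence].
    + intros x (t & Ht%in_trees_of_size & (s & <- & Hs%in_trees_of_size)%in_map_iff)%in_flat_map.
      apply in_trees_of_size. pose proof (tsize_graft t s). lia.
Qed.

Definition partial_mean (nu : nat -> R) (B : nat) : R :=
  lsum (fun k => INR k * nu k) (seq 0 B).

Definition subprobability (nu : nat -> R) : Prop :=
  (forall k, 0 <= nu k) /\ forall B, lsum nu (seq 0 B) <= 1.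

Lemma critical_subprobability mu : critical_offspring mu -> subprobability mu.
Proof. intros (Hmu & Hmass & _). split; auto using infinite_sum_partial_le. Qed.

Lemma critical_partial_mean_ge mu eps : critical_offspring mu -> 0 < eps ->
  exists K, forall B, (K <= B)%nat -> 1 - eps <= partial_mean mu B.
Proof.
  intros (Hmu & _ & Hmean). apply infinite_sum_partial_ge; [|assumption].
  intros k. apply Rmult_le_pos; [apply pos_INR|auto].
Qed.

Lemma critical_partial_mean_le mu B : critical_offspring mu -> partial_mean mu B <= 1.
Proof.
  intros (Hmu & _ & Hmean). apply infinite_sum_partial_le; [|assumption].
  intros k. apply Rmult_le_pos; [apply pos_INR|auto].
Qed.

(* The generating function is convex and, by criticality, has the diagonal as tangent at 1. *)
Lemma critical_pgf_ge mu y eps : critical_offspring mu -> 0 <= y -> 0 < eps ->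
  exists B, y - eps <= lsum (fun k => mu k * y ^ k) (seq 0 B).
Proof.
  intros Hcrit Hy Heps. pose proof Hcrit as (Hmu & Hmass & _).
  set (e := eps / (y + 2)).
  assert (He : 0 < e) by (apply Rdiv_lt_0_compat; lra).
  assert (Heq : e * (y + 2) = eps) by (unfold e; field; lra).
  destruct (infinite_sum_partial_ge mu 1 e Hmu Hmass He) as [K1 HK1].
  destruct (critical_partial_mean_ge mu e Hcrit He) as [K2 HK2].
  exists (K1 + K2)%nat. set (B := (K1 + K2)%nat).
  specialize (HK1 B ltac:(unfold B; lia)). specialize (HK2 B ltac:(unfold B; lia)).
  pose proof (critical_partial_mean_le mu B Hcrit).
  transitivity (lsum mu (seq 0 B) + (y - 1) * partial_mean mu B).
  - destruct (Rle_dec 1 y); nra.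
  - unfold partial_mean. rewrite <- lsum_scal, <- big_op. apply lsum_le_in. intros k _.
    pose proof (Rmult_le_compat_l _ _ _ (Hmu k) (bernoulli_inequality y k Hy)). lra.
Qed.

Definition tree_gf (mu : nat -> R) (z : R) (N : nat) : R :=
  lsum (weight (fun k => z * mu k)) (trees_upto N).

Lemma tree_gf_prob_size mu z N :
  tree_gf mu z N = lsum (fun n => z ^ n * prob_size mu n) (seq 0 (S N)).
Proof.
  unfold tree_gf, trees_upto. rewrite big_flat_map. apply big_ext_in. intros n _.
  rewrite prob_size_lsum, <- lsum_scal. apply big_ext_in. intros t Ht%in_trees_of_size.
  now rewrite weight_scal, Ht.
Qed.

(* The fixed point equation A(z) = z G(A(z)), where G(y) >= y by criticality. *)
Lemma tree_gf_bound_improves mu z b : critical_offspring mu -> 0 < z ->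
  (forall N, tree_gf mu z N <= b) -> forall N, z * tree_gf mu z N <= b.
Proof.
  intros Hcrit Hz Hb N. pose proof Hcrit as (Hmu & _).
  assert (Hzmu : forall k, 0 <= z * mu k) by (intros; apply Rmult_le_pos; [lra|auto]).
  set (y := tree_gf mu z N).
  assert (Hy : 0 <= y) by (apply lsum_nonneg; auto using weight_nonneg).
  apply le_epsilon. intros eps Heps.
  destruct (critical_pgf_ge mu y (eps / z) Hcrit Hy) as [B HB];
    [now apply Rdiv_lt_0_compat|].
  apply (Rmult_le_compat_l z) in HB; [|lra]. rewrite <- lsum_scal in HB.
  replace (z * (y - eps / z)) with (z * y - eps) in HB by (field; lra).
  enough (lsum (fun k => z * (mu k * y ^ k)) (seq 0 B) <= b) by lra.
  eapply Rle_trans; [|apply (Hb (S (B * N)))].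
  eapply Rle_trans; [|apply (branching_sum_ge (fun k => z * mu k) _
    (weight (fun k => z * mu k))); auto using weight_nonneg, weight_Node].
  right. apply big_ext_in. intros k _. fold (tree_gf mu z N) y. ring.
Qed.

Lemma tree_gf_unbounded mu z b : critical_offspring mu -> 0 < mu 0%nat -> 1 < z ->
  exists N, b < tree_gf mu z N.
Proof.
  intros Hcrit Hleaf Hz. apply NNPP. intros Hno.
  destruct (completeness (fun y => exists N, y = tree_gf mu z N)) as [s [Hub Hlub]].
  { exists b. intros y [N ->]. apply Rnot_lt_le. intros Hlt. apply Hno. now exists N. }
  { exists (tree_gf mu z 0), 0%nat. reflexivity. }
  assert (Hs : forall N, tree_gf mu z N <= s) by (intros N; apply Hub; now exists N).
  assert (Hpos : 0 < s).
  { apply Rlt_le_trans with (tree_gf mu z 1); [|apply Hs].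
    rewrite tree_gf_prob_size. cbn. nra. }
  assert (Hsz : s <= s / z).
  { apply Hlub. intros y [N ->]. apply (Rmult_le_reg_l z); [lra|].
    replace (z * (s / z)) with s by (field; lra).
    apply tree_gf_bound_improves; auto; lra. }
  apply (Rmult_le_compat_l z) in Hsz; [|lra].
  replace (z * (s / z)) with s in Hsz by (field; lra). nra.
Qed.

Lemma prob_size_not_exp_small mu eta : critical_offspring mu -> 0 < mu 0%nat -> 0 < eta ->
  exists m, (1 <= m)%nat /\ mu 0%nat * exp (- (INR m * eta)) <= prob_size mu (S m).
Proof.
  intros Hcrit Hleaf Heta. apply NNPP. intros Hno.
  assert (Hsmall : forall m, prob_size mu (S m) <= mu 0%nat * exp (- (INR m * eta))).
  { intros [|m].
    - rewrite prob_size_1. simpl INR. rewrite Rmult_0_l, Ropp_0, exp_0. lra.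
    - apply Rnot_lt_le. intros Hlt. apply Hno. exists (S m). split; [lia|lra]. }
  set (z := exp (eta / 2)). set (r := exp (- (eta / 2))).
  assert (Hz : 1 < z) by (unfold z; rewrite <- exp_0; apply exp_increasing; lra).
  assert (Hr : 0 <= r < 1).
  { split; [left; apply exp_pos|]. unfold r. rewrite <- exp_0. apply exp_increasing; lra. }
  assert (Hterm : forall n, z ^ n * prob_size mu n <= mu 0%nat * (z * z) * r ^ n).
  { intros [|n]; [unfold prob_size; cbn; nra|].
    transitivity (z ^ S n * (mu 0%nat * exp (- (INR n * eta)))).
    - apply Rmult_le_compat_l; [apply pow_le; lra|apply Hsmall].
    - right. unfold z, r. rewrite !exp_pow, (Rmult_comm (exp _)), !Rmult_assoc, <- !exp_plus.
      do 2 f_equal. rewrite S_INR. field. }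
  destruct (tree_gf_unbounded mu z (mu 0%nat * (z * z) * / (1 - r)) Hcrit Hleaf Hz) as [N HN].
  apply Rlt_not_le in HN. apply HN. rewrite tree_gf_prob_size.
  eapply Rle_trans; [apply lsum_le_in; intros; apply Hterm|].
  rewrite lsum_scal. apply Rmult_le_compat_l; [nra|]. now apply lsum_geom_le.
Qed.

Section Supermultiplicative.

Variables (c : nat -> R) (eta : R) (m : nat).
Hypothesis c_supermult : forall i j, c i * c j <= c (i + j)%nat.
Hypothesis eta_nonneg : 0 <= eta.
Hypothesis m_pos : (1 <= m)%nat.
Hypothesis c_m_lower : exp (- (INR m * eta)) <= c m.

Lemma supermult_iterate i j :
  0 < c i -> c i * exp (- (INR (j * m) * eta)) <= c (i + j * m)%nat.
Proof.
  intros Hi. induction j as [|j IH].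
  - simpl. rewrite Rmult_0_l, Ropp_0, exp_0, Nat.add_0_r. lra.
  - replace (i + S j * m)%nat with ((i + j * m) + m)%nat by lia.
    eapply Rle_trans; [|apply c_supermult].
    replace (- (INR (S j * m) * eta)) with (- (INR (j * m) * eta) + - (INR m * eta))
      by (rewrite !mult_INR, S_INR; ring).
    rewrite exp_plus, <- Rmult_assoc.
    apply Rmult_le_compat; auto; [|left; apply exp_pos].
    apply Rmult_le_pos; [lra|left; apply exp_pos].
Qed.

Lemma supermult_residue_lower r : exists kappa, 0 < kappa /\
  forall n, (n mod m = r)%nat -> 0 < c n -> kappa * exp (- (INR n * eta)) <= c n.
Proof.
  destruct (classic (exists n, (n mod m = r)%nat /\ 0 < c n)) as [Hex|Hnone].
  2:{ exists 1. split; [lra|]. intros n Hn Hcn. exfalso. apply Hnone. now exists n. }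
  destruct (dec_inh_nat_subset_has_unique_least_element _ (fun n => classic _) Hex)
    as (n0 & [[Hn0 Hc0] Hleast] & _).
  exists (c n0). split; [assumption|]. intros n Hn Hcn.
  assert (Hle : (n0 <= n)%nat) by now apply Hleast.
  assert (exists j, n = n0 + j * m)%nat as [j ->].
  { exists (n / m - n0 / m)%nat.
    pose proof (Nat.div_mod_eq n m). pose proof (Nat.div_mod_eq n0 m).
    rewrite Nat.mul_sub_distr_r. nia. }
  eapply Rle_trans; [|now apply supermult_iterate].
  apply Rmult_le_compat_l; [lra|]. apply exp_le_compat.
  rewrite plus_INR. pose proof (pos_INR n0). nra.
Qed.

(* A Fekete argument: the good index [m] propagates along each residue class mod [m]. *)
Lemma supermult_exp_lower : exists kappa, 0 < kappa /\
  forall n, 0 < c n -> kappa * exp (- (INR n * eta)) <= c n.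
Proof.
  assert (Hresidues : forall r, exists kappa, 0 < kappa /\ forall n, (n mod m < r)%nat ->
    0 < c n -> kappa * exp (- (INR n * eta)) <= c n).
  { induction r as [|r (kappa & Hkappa & IH)]; [exists 1; split; [lra|]; lia|].
    destruct (supermult_residue_lower r) as (kappa' & Hkappa' & Hr).
    exists (Rmin kappa kappa'). split; [now apply Rmin_glb_lt|]. intros n Hn Hcn.
    pose proof (exp_pos (- (INR n * eta))).
    destruct (Nat.eq_dec (n mod m) r) as [Heq|Hneq].
    - eapply Rle_trans; [|now apply Hr]. apply Rmult_le_compat_r; [lra|apply Rmin_r].
    - eapply Rle_trans; [|apply IH; [lia|assumption]].
      apply Rmult_le_compat_r; [lra|apply Rmin_l]. }
  destruct (Hresidues m) as (kappa & Hkappa & Hall). exists kappa. split; [assumption|].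
  intros n. apply Hall, Nat.mod_upper_bound. lia.
Qed.

End Supermultiplicative.

Lemma prob_size_subexponential mu eta : critical_offspring mu -> 0 < mu 0%nat -> 0 < eta ->
  exists kappa, 0 < kappa /\
    forall n, 0 < prob_size mu n -> kappa * exp (- (eta * INR n)) <= prob_size mu n.
Proof.
  intros Hcrit Hleaf Heta. pose proof Hcrit as (Hmu & _).
  destruct (prob_size_not_exp_small mu eta Hcrit Hleaf Heta) as (m & Hm & Hpm).
  destruct (supermult_exp_lower (fun n => prob_size mu (S n) / mu 0%nat) eta m)
    as (kappa & Hkappa & Hlow); [|lra|assumption| |].
  { intros i j. pose proof (prob_size_supermult mu i j Hmu) as Hsup.
    apply (Rmult_le_compat_r (/ mu 0%nat * / mu 0%nat)) in Hsup; [|nra].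
    unfold Rdiv. field_simplify in Hsup; [|lra|lra]. field_simplify; lra. }
  { apply (Rmult_le_reg_l (mu 0%nat)); [assumption|].
    unfold Rdiv. field_simplify; lra. }
  exists (kappa * mu 0%nat). split; [nra|].
  intros [|n] Hp; [unfold prob_size in Hp; cbn in Hp; lra|].
  specialize (Hlow n ltac:(now apply Rdiv_lt_0_compat)).
  apply (Rmult_le_compat_l (mu 0%nat)) in Hlow; [|lra].
  replace (mu 0%nat * (prob_size mu (S n) / mu 0%nat)) with (prob_size mu (S n)) in Hlow
    by (field; lra).
  eapply Rle_trans; [|apply Hlow].
  transitivity (mu 0%nat * (kappa * exp (- (eta * INR (S n))))); [right; ring|].
  apply Rmult_le_compat_l; [lra|]. apply Rmult_le_compat_l; [lra|].
  apply exp_le_compat. rewrite S_INR. lra.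
Qed.

Lemma exp_negligible mu c eps : critical_offspring mu -> 0 < c -> 0 < eps ->
  exists N, forall n, (N <= n)%nat -> 0 < prob_size mu n ->
    INR n * exp (- (c * INR n)) < eps * prob_size mu n.
Proof.
  intros Hcrit Hc Heps.
  destruct (proj1 Hcrit 0%nat) as [Hleaf|Hno_leaf].
  2:{ exists 0%nat. intros n _ Hp. rewrite prob_size_no_leaf in Hp by easy. lra. }
  destruct (prob_size_subexponential mu (c / 2) Hcrit Hleaf) as (kappa & Hkappa & Hlow); [lra|].
  destruct (mul_exp_eventually_small (c / 2) (eps * kappa)) as [N HN]; [lra|nra|].
  exists N. intros n Hn Hp. specialize (HN n Hn). specialize (Hlow n Hp).
  replace (- (c * INR n)) with (- (c / 2 * INR n) + - (c / 2 * INR n)) by field.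
  rewrite exp_plus. pose proof (exp_pos (- (c / 2 * INR n))). nra.
Qed.

(** * Exponentially unlikely events *)

Definition mass (mu : nat -> R) (n : nat) (A : tree -> bool) : R :=
  lsum (fun t => if A t then weight mu t else 0) (trees_of_size n).

Lemma Pcond_lt mu n A eps : 0 < prob_size mu n ->
  mass mu n A < eps * prob_size mu n -> Pcond mu n A < eps.
Proof.
  intros Hp Hlt. apply (Rmult_lt_reg_r (prob_size mu n)); [assumption|].
  change (Pcond mu n A) with (mass mu n A / prob_size mu n).
  unfold Rdiv. rewrite Rmult_assoc, Rinv_l, Rmult_1_r; lra.
Qed.

Lemma mass_le_exp mu n A (g : tree -> R) x : (forall t, 0 <= g t) ->
  lsum g (trees_upto n) <= 1 ->
  (forall t, tsize t = n -> A t = true -> weight mu t * exp x <= g t) ->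
  mass mu n A <= exp (- x).
Proof.
  intros Hg Hsum Hle. apply (Rmult_le_reg_r (exp x)); [apply exp_pos|].
  rewrite <- exp_plus, Rplus_opp_l, exp_0. eapply Rle_trans; [|apply Hsum].
  eapply Rle_trans; [|now apply lsum_trees_of_size_le].
  unfold mass. rewrite <- lsum_scal_r. apply lsum_le_in. intros t Ht%in_trees_of_size.
  destruct (A t) eqn:HA; [now apply Hle|]. now rewrite Rmult_0_l.
Qed.

Lemma weight_sum_le v y N : (forall k, 0 <= v k) -> 0 <= y ->
  (forall B, lsum (fun k => v k * y ^ k) (seq 0 B) <= y) ->
  lsum (weight v) (trees_upto N) <= y.
Proof.
  intros Hv Hy Hsub. induction N as [|N IH]; [assumption|].
  apply (branching_sum_bound v _ (weight v) Hv) with y; auto using weight_nonneg, weight_Node.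
Qed.

Definition cutoff (B k : nat) : nat := if (k <? B)%nat then k else 0%nat.

Lemma cutoff_le_id B k : (cutoff B k <= k)%nat.
Proof. unfold cutoff. destruct (Nat.ltb_spec k B); lia. Qed.

Lemma cutoff_le_bound B k : (cutoff B k <= B)%nat.
Proof. unfold cutoff. destruct (Nat.ltb_spec k B); lia. Qed.

Lemma partial_mean_cutoff nu B :
  partial_mean nu B = lsum (fun k => nu k * INR (cutoff B k)) (seq 0 B).
Proof.
  apply big_ext_in. intros k Hk%in_seq. unfold cutoff.
  destruct (Nat.ltb_spec k B); [ring|lia].
Qed.

Section Laplace.

Variables (nu : nat -> R) (B : nat) (eps lam : R).
Hypothesis nu_subprob : subprobability nu.
Hypothesis nu_mean : 1 - eps <= partial_mean nu B.
Hypothesis lam_nonneg : 0 <= lam.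
Hypothesis lam_small : lam * (INR B * INR B) <= eps.

Lemma exp_cutoff_le k :
  exp (- (lam * INR (cutoff B k))) <= 1 + lam * eps - lam * INR (cutoff B k).
Proof.
  pose proof (pos_INR (cutoff B k)) as Hpos.
  pose proof (le_INR _ _ (cutoff_le_bound B k)) as Hle.
  eapply Rle_trans; [apply exp_opp_le_quadratic; nra|].
  enough (lam * (lam * (INR (cutoff B k) * INR (cutoff B k))) <= lam * eps) by lra.
  apply Rmult_le_compat_l; [assumption|]. eapply Rle_trans; [|apply lam_small].
  apply Rmult_le_compat_l; [assumption|]. now apply Rmult_le_compat.
Qed.

Lemma laplace_cutoff_le B' :
  lsum (fun k => nu k * exp (- (lam * INR (cutoff B k)))) (seq 0 B')
    <= exp (- (lam * (1 - 2 * eps))).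
Proof.
  destruct nu_subprob as [Hnu Hmass].
  assert (Hcut : 1 - eps <= lsum (fun k => nu k * INR (cutoff B k)) (seq 0 (B' + B))).
  { eapply Rle_trans; [apply nu_mean|]. rewrite partial_mean_cutoff.
    apply lsum_seq_mono; [|lia]. intros k. apply Rmult_le_pos; auto using pos_INR. }
  eapply Rle_trans; [apply (lsum_seq_mono _ B' (B' + B)); [|lia]|].
  { intros k. apply Rmult_le_pos; [auto|left; apply exp_pos]. }
  eapply Rle_trans; [apply lsum_le_in|].
  { intros k _. apply Rmult_le_compat_l; [auto|apply exp_cutoff_le]. }
  rewrite (big_ext_in _ _ _
    (fun k => (1 + lam * eps) * nu k + - lam * (nu k * INR (cutoff B k)))) by (intros; ring).
  rewrite big_op, !lsum_scal. eapply Rle_trans; [|apply exp_ineq1_le].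
  specialize (Hmass (B' + B)%nat).
  apply (Rmult_le_compat_l (1 + lam * eps)) in Hmass; [|nra].
  apply (Rmult_le_compat_l lam) in Hcut; lra.
Qed.

Lemma laplace_le B' :
  lsum (fun k => nu k * exp (- lam) ^ k) (seq 0 B') <= exp (- (lam * (1 - 2 * eps))).
Proof.
  eapply Rle_trans; [|apply laplace_cutoff_le]. apply lsum_le_in. intros k _.
  apply Rmult_le_compat_l; [apply nu_subprob|]. rewrite exp_pow. apply exp_le_compat.
  pose proof (le_INR _ _ (cutoff_le_id B k)). nra.
Qed.

End Laplace.

Lemma exists_laplace_scale B eps : 0 < eps ->
  exists lam, 0 < lam /\ lam * (INR B * INR B) <= eps.
Proof.
  intros Heps. exists (eps / (1 + INR B * INR B)).
  assert (Hlam : 0 < eps / (1 + INR B * INR B)) by (apply Rdiv_lt_0_compat; nra).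
  split; [assumption|].
  transitivity (eps / (1 + INR B * INR B) * (1 + INR B * INR B)); [nra|].
  right. field. nra.
Qed.

Lemma critical_laplace_scale mu eps : critical_offspring mu -> 0 < eps ->
  exists B lam, 0 < lam /\ lam * (INR B * INR B) <= eps /\ 1 - eps <= partial_mean mu B.
Proof.
  intros Hcrit Heps. destruct (critical_partial_mean_ge mu eps Hcrit Heps) as [B HB].
  destruct (exists_laplace_scale B eps Heps) as (lam & Hlam & Hsmall).
  exists B, lam. auto.
Qed.

(* The left-hand side is E[x^|T| s^(-Z_k); |T| <= N], where Z_k = gen k T. *)
Lemma gen_transform_le mu x s k N : subprobability mu -> 0 <= x <= 1 -> 0 < s ->
  (forall B, lsum (fun j => x * mu j * s ^ j) (seq 0 B) <= s) ->
  lsum (fun t => weight (fun j => x * mu j) t * (/ s) ^ gen k t) (trees_upto N) <= 1.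
Proof.
  intros [Hmu Hmass] Hx Hs Hfix. pose proof (Rinv_0_lt_compat s Hs) as Hinv.
  assert (Hxmu : forall j, 0 <= x * mu j) by (intros; apply Rmult_le_pos; [lra|auto]).
  revert N. induction k as [|k IH]; intros N.
  - rewrite (big_ext_in _ _ _ (fun t => weight (fun j => x * mu j) t * / s))
      by (intros [f] _; cbn [gen]; ring).
    rewrite lsum_scal_r. apply (Rmult_le_reg_r s); [assumption|].
    rewrite Rmult_assoc, Rinv_l, Rmult_1_r, Rmult_1_l by lra. apply weight_sum_le; auto; lra.
  - destruct N as [|N]; [cbn; lra|].
    apply (branching_sum_bound (fun j => x * mu j) _
      (fun t => weight (fun j => x * mu j) t * (/ s) ^ gen k t)) with 1; auto.
    + intros t. apply Rmult_le_pos; [now apply weight_nonneg|apply pow_le; lra].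
    + intros f. cbn [gen]. rewrite weight_Node, <- lprod_pow, Rmult_assoc, <- big_op. reflexivity.
    + intros B. rewrite (big_ext_in _ _ _ (fun j => x * mu j)) by (intros; rewrite pow1; ring).
      rewrite lsum_scal. specialize (Hmass B). nra.
Qed.

(* With s = exp (- lam) and x = exp (- lam delta / 2) one has x G(s) <= s, so x^|T| s^(- Z_k)
   has mean at most 1, while it is at least exp (lam delta n / 2) when Z_k > delta n. *)
Lemma large_gen_exp_small mu delta : critical_offspring mu -> 0 < delta ->
  exists c, 0 < c /\ forall n k,
    mass mu n (fun t => Rltb (delta * INR n) (INR (gen k t))) <= exp (- (c * INR n)).
Proof.
  intros Hcrit Hdelta. pose proof Hcrit as (Hmu & _).
  pose proof (critical_subprobability mu Hcrit) as Hsub.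
  destruct (critical_laplace_scale mu (delta / 4) Hcrit) as (B & lam & Hlam & Hsmall & Hmean);
    [lra|].
  exists (lam * delta / 2). split; [nra|]. intros n k.
  set (s := exp (- lam)). set (x := exp (- (lam * delta / 2))).
  assert (Hx : 0 <= x <= 1) by (split; [left; apply exp_pos|apply exp_opp_le_1; nra]).
  assert (Hs : 0 < s) by apply exp_pos.
  assert (Hxmu : forall j, 0 <= x * mu j) by (intros; apply Rmult_le_pos; [lra|auto]).
  apply mass_le_exp with (fun t => weight (fun j => x * mu j) t * (/ s) ^ gen k t).
  - intros t. apply Rmult_le_pos; [now apply weight_nonneg|].
    apply pow_le. left. now apply Rinv_0_lt_compat.
  - apply gen_transform_le; auto. intros B'.
    rewrite (big_ext_in _ _ _ (fun j => x * (mu j * s ^ j))) by (intros; ring).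
    rewrite lsum_scal. transitivity (x * exp (- (lam * (1 - 2 * (delta / 4))))).
    + apply Rmult_le_compat_l; [lra|]. apply laplace_le with B; auto; lra.
    + right. unfold x, s. rewrite <- exp_plus. f_equal. field.
  - intros t Ht Hgen. destruct (Rltb_spec (delta * INR n) (INR (gen k t))); [|discriminate].
    rewrite weight_scal, Ht, (Rmult_comm (x ^ n)), Rmult_assoc.
    apply Rmult_le_compat_l; [now apply weight_nonneg|].
    unfold x, s. rewrite <- exp_Ropp, !exp_pow, <- exp_plus. apply exp_le_compat. nra.
Qed.

(* On the empty list this is the zero function, since Rocq's division by zero gives [0]. *)
Definition freq (w : list nat) (k : nat) : R :=
  INR (count_occ Nat.eq_dec w k) / INR (length w).

Lemma freq_subprobability w : subprobability (freq w).
Proof.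
  assert (Hinv : 0 <= / INR (length w)).
  { destruct (pos_INR (length w)) as [Hn|<-]; [left; now apply Rinv_0_lt_compat|].
    rewrite Rinv_0. lra. }
  split; [intros k; apply Rmult_le_pos; auto using pos_INR|]. intros B.
  transitivity (INR (length w) * / INR (length w)).
  2:{ destruct (Req_dec (INR (length w)) 0) as [->|Hn]; [lra|rewrite Rinv_r; lra]. }
  unfold freq, Rdiv. rewrite lsum_scal_r. apply Rmult_le_compat_r; [assumption|].
  rewrite (big_ext_in _ _ _ (fun k => INR (count_occ Nat.eq_dec w k) * ind (k <? B)%nat)).
  - rewrite lsum_count_occ, INR_length; [|apply seq_NoDup|].
    + apply lsum_le_in. intros a _. apply ind_bounds.
    + intros a _ Hout. rewrite in_seq in Hout. destruct (Nat.ltb_spec a B); [lia|reflexivity].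
  - intros k Hk%in_seq. destruct (Nat.ltb_spec k B); [cbn; ring|lia].
Qed.

Lemma partial_mean_freq w B :
  partial_mean (freq w) B = lsum (fun k => INR (cutoff B k)) w / INR (length w).
Proof.
  rewrite partial_mean_cutoff, <- (lsum_count_occ _ w (seq 0 B)).
  - unfold Rdiv. rewrite <- lsum_scal_r. apply big_ext_in. intros; unfold freq, Rdiv; ring.
  - apply seq_NoDup.
  - intros a _ Hout. rewrite in_seq in Hout. unfold cutoff.
    destruct (Nat.ltb_spec a B); [lia|reflexivity].
Qed.

Lemma low_mean_exp_small mu eps : critical_offspring mu -> 0 < eps ->
  exists B c, 0 < c /\ forall n,
    mass mu n (fun t => Rltb (partial_mean (freq (degs t)) B) (1 - eps))
      <= exp (- (c * INR n)).
Proof.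
  intros Hcrit Heps. pose proof Hcrit as (Hmu & _).
  destruct (critical_laplace_scale mu (eps / 4) Hcrit) as (B & lam & Hlam & Hsmall & Hmean);
    [lra|].
  exists B, (lam * eps / 2). split; [nra|]. intros n.
  set (tilt := fun k => exp (lam * (1 - eps / 2) + - lam * INR (cutoff B k))).
  set (v := fun k => mu k * tilt k).
  assert (Hv : forall k, 0 <= v k)
    by (intros; apply Rmult_le_pos; [auto|left; apply exp_pos]).
  apply mass_le_exp with (weight v); auto using weight_nonneg.
  - apply weight_sum_le; auto; [lra|]. intros B'.
    rewrite (big_ext_in _ _ _ (fun k => exp (lam * (1 - eps / 2))
      * (mu k * exp (- (lam * INR (cutoff B k)))))).
    2:{ intros k _. rewrite pow1. unfold v, tilt.
        rewrite exp_plus, Ropp_mult_distr_l. ring. }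
    rewrite lsum_scal.
    transitivity (exp (lam * (1 - eps / 2)) * exp (- (lam * (1 - 2 * (eps / 4))))).
    + apply Rmult_le_compat_l; [left; apply exp_pos|].
      apply laplace_cutoff_le; auto using critical_subprobability; lra.
    + right. rewrite <- exp_plus, <- exp_0. f_equal. field.
  - intros t Ht Hlow. rewrite (weight_degs v). unfold v. rewrite big_op, <- weight_degs.
    apply Rmult_le_compat_l; [now apply weight_nonneg|].
    unfold tilt. rewrite lprod_exp. apply exp_le_compat.
    rewrite big_op, lsum_const, lsum_scal, length_degs, Ht.
    destruct (Rltb_spec (partial_mean (freq (degs t)) B) (1 - eps)) as [Hlt|]; [|discriminate].
    rewrite partial_mean_freq, length_degs, Ht in Hlt.
    assert (Hn : 0 < INR n) by (apply lt_0_INR; pose proof (tsize_pos t); lia).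
    apply (Rmult_lt_compat_r (INR n)) in Hlt; [|assumption].
    unfold Rdiv in Hlt. rewrite Rmult_assoc, Rinv_l, Rmult_1_r in Hlt by lra.
    apply (Rmult_lt_compat_l lam) in Hlt; lra.
Qed.

Lemma height_lt_S f h :
  (height (Node f) <? S h)%nat = forallb (fun c => height c <? h)%nat f.
Proof.
  induction f as [|c f IH]; [reflexivity|]. cbn [forallb]. rewrite <- IH. cbn [height fold_right].
  set (m := fold_right _ _ f).
  destruct (Nat.ltb_spec (height c) h), (Nat.ltb_spec m (S h)),
    (Nat.ltb_spec (Nat.max (S (height c)) m) (S h)); reflexivity || lia.
Qed.

Lemma lprod_if {A} (p : A -> bool) (u : A -> R) l :
  lprod (fun a => if p a then u a else 0) l = if forallb p l then lprod u l else 0.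
Proof.
  induction l as [|a l IH]; [reflexivity|]. rewrite !big_cons, IH. cbn [forallb].
  destruct (p a), (forallb p l); cbn [andb]; ring.
Qed.

Definition short_weight (v : nat -> R) (h : nat) (t : tree) : R :=
  if (height t <? h)%nat then weight v t else 0.

Lemma short_weight_Node v h f :
  short_weight v (S h) (Node f) = v (length f) * lprod (short_weight v h) f.
Proof.
  unfold short_weight. rewrite height_lt_S, lprod_if, weight_Node.
  destruct (forallb _ f); ring.
Qed.

Lemma short_weight_nonneg v h t : (forall k, 0 <= v k) -> 0 <= short_weight v h t.
Proof.
  intros Hv. unfold short_weight. destruct (height t <? h)%nat; [|lra].
  now apply weight_nonneg.
Qed.

Section ShortTrees.

Variables (nu : nat -> R) (B : nat) (eps lam : R).
Hypothesis nu_subprob : subprobability nu.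
Hypothesis nu_mean : 1 - eps <= partial_mean nu B.
Hypothesis lam_nonneg : 0 <= lam.
Hypothesis lam_small : lam * (INR B * INR B) <= eps.
Hypothesis eps_bounds : 0 <= eps <= / 3.

Lemma ratio_pow_bounds k : 0 <= (1 - 3 * eps) ^ k <= 1.
Proof.
  split; [apply pow_le; lra|].
  pose proof (pow_incr (1 - 3 * eps) 1 k) as Hle. rewrite pow1 in Hle. apply Hle. lra.
Qed.

(* One generation multiplies the exponent [lam * r ^ k] by [r = 1 - 3 * eps]: the Laplace
   transform gives [1 - 2 * eps] and the factor [exp b] per vertex costs at most [eps]. *)
Lemma short_weight_sum_le b h k N : 0 <= b <= eps * lam * (1 - 3 * eps) ^ h -> (k <= h)%nat ->
  lsum (short_weight (fun j => exp b * nu j) k) (trees_upto N)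
    <= exp (- (lam * (1 - 3 * eps) ^ k)).
Proof.
  intros Hb. pose proof (proj1 nu_subprob) as Hnu. revert N. set (r := 1 - 3 * eps) in *.
  assert (Hv : forall j, 0 <= exp b * nu j)
    by (intros; apply Rmult_le_pos; [left; apply exp_pos|auto]).
  induction k as [|k IH]; intros [|N] Hk; try (left; apply exp_pos).
  { rewrite (big_ext_in _ _ _ (fun _ => 0)) by reflexivity.
    rewrite big_unit. left; apply exp_pos. }
  apply (branching_sum_bound (fun j => exp b * nu j) _
    (short_weight (fun j => exp b * nu j) k)) with (exp (- (lam * r ^ k)));
    auto using short_weight_nonneg, short_weight_Node; [apply IH; lia|].
  intros B'.
  rewrite (big_ext_in _ _ _ (fun j => exp b * (nu j * exp (- (lam * r ^ k)) ^ j)))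
    by (intros; ring).
  rewrite lsum_scal. destruct (ratio_pow_bounds k) as [Hk0 Hk1]. fold r in Hk0, Hk1.
  transitivity (exp b * exp (- (lam * r ^ k * (1 - 2 * eps)))).
  - apply Rmult_le_compat_l; [left; apply exp_pos|]. apply laplace_le with B; auto; [nra|].
    nra.
  - rewrite <- exp_plus. apply exp_le_compat. cbn [pow].
    assert (r ^ h <= r ^ k).
    { replace h with (k + (h - k))%nat by lia. rewrite pow_add.
      pose proof (ratio_pow_bounds (h - k)) as Hhk. fold r in Hhk. nra. }
    assert (eps * lam * r ^ h <= eps * lam * r ^ k) by (apply Rmult_le_compat_l; nra).
    unfold r in *. nra.
Qed.

Lemma short_exp_small h n :
  mass nu n (fun t => height t <? h)%nat <= exp (- (eps * lam * (1 - 3 * eps) ^ h * INR n)).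
Proof.
  set (b := eps * lam * (1 - 3 * eps) ^ h). pose proof (proj1 nu_subprob) as Hnu.
  pose proof (ratio_pow_bounds h) as Hh.
  assert (Hb : 0 <= b) by (unfold b; repeat apply Rmult_le_pos; lra).
  apply mass_le_exp with (short_weight (fun j => exp b * nu j) h).
  - intros t. apply short_weight_nonneg. intros j.
    apply Rmult_le_pos; [left; apply exp_pos|auto].
  - eapply Rle_trans; [apply (short_weight_sum_le b h); [unfold b in *; lra|lia]|].
    apply exp_opp_le_1. apply Rmult_le_pos; lra.
  - intros t Ht Hshort. unfold short_weight. rewrite Hshort, weight_scal, Ht, exp_pow.
    right. rewrite (Rmult_comm (INR n)). ring.
Qed.

End ShortTrees.

(** * Counting trees with given degrees *)

Definition permb (w w' : list nat) : bool :=
  if excluded_middle_informative (Permutation w w') then true else false.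

Lemma permb_true w w' : permb w w' = true <-> Permutation w w'.
Proof.
  unfold permb. destruct (excluded_middle_informative _); split; auto; discriminate.
Qed.

Definition forests_of_type (w : list nat) : list (list tree) :=
  filter (fun f => permb w (fdegs f)) (forests_of_size (length w)).

Lemma in_forests_of_type w f : In f (forests_of_type w) <-> Permutation w (fdegs f).
Proof.
  unfold forests_of_type. rewrite filter_In, in_forests_of_size, permb_true.
  split; [tauto|]. intros Hw. split; [|assumption].
  now rewrite <- length_fdegs, (Permutation_length Hw).
Qed.

Lemma NoDup_forests_of_type w : NoDup (forests_of_type w).
Proof. apply NoDup_filter, NoDup_forests_of_size. Qed.

Lemma length_of_type w f :
  In f (forests_of_type w) -> (length f + list_sum w)%nat = length w.
Proof.
  intros Hf%in_forests_of_type.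
  rewrite (list_sum_perm _ _ Hf), (Permutation_length Hf), length_fdegs. apply sum_fdegs.
Qed.

Definition add_root (k : nat) (q : list tree) : list tree :=
  Node (firstn k q) :: skipn k q.

Lemma fdegs_add_root k q : (k <= length q)%nat -> fdegs (add_root k q) = k :: fdegs q.
Proof.
  intros Hk. unfold add_root. rewrite fdegs_Node_cons, length_firstn, Nat.min_l by assumption.
  f_equal. unfold fdegs. now rewrite <- flat_map_app, firstn_skipn.
Qed.

Lemma add_root_inj k q q' : add_root k q = add_root k q' -> q = q'.
Proof.
  intros [= Hfirst Hskip]. now rewrite <- (firstn_skipn k q), <- (firstn_skipn k q'), Hfirst, Hskip.
Qed.

(* Deleting the first root of a forest turns its children into roots. *)
Lemma forests_of_type_recurrence w : (list_sum w < length w)%nat ->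
  lsum (fun k => INR (length (forests_of_type (remove_one k w)))) (nodup Nat.eq_dec w)
    <= INR (length (forests_of_type w)).
Proof.
  intros Hroots.
  set (grown := flat_map (fun k => map (add_root k) (forests_of_type (remove_one k w)))
    (nodup Nat.eq_dec w)).
  assert (Hlen : forall k q, In k w -> In q (forests_of_type (remove_one k w)) ->
    (k <= length q)%nat).
  { intros k q [Hw1 Hw2]%remove_one_size Hq%length_of_type. lia. }
  transitivity (INR (length grown)).
  { right. unfold grown. rewrite INR_length, big_flat_map. apply big_ext_in. intros k _.
    now rewrite <- INR_length, length_map. }
  apply le_INR, NoDup_incl_length.
  - apply NoDup_flat_map; [apply NoDup_nodup| |].
    + intros k _. apply NoDup_map_NoDup_ForallPairs, NoDup_forests_of_type.
      intros q q' _ _. apply add_root_inj.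
    + intros k k' f Hk%nodup_In Hk'%nodup_In (q & <- & Hq)%in_map_iff.
      intros (q' & Heq & Hq')%in_map_iff. apply Hlen in Hq, Hq'; auto.
      injection Heq as Heq _. apply (f_equal (@length tree)) in Heq.
      rewrite !length_firstn in Heq. lia.
  - intros f (k & Hk%nodup_In & (q & <- & Hq)%in_map_iff)%in_flat_map.
    pose proof (Hlen k q Hk Hq). apply in_forests_of_type in Hq. apply in_forests_of_type.
    rewrite fdegs_add_root by assumption. rewrite (remove_one_perm k w Hk). now constructor.
Qed.

Definition type_factorial (l w : list nat) : R :=
  lprod (fun k => INR (fact (count_occ Nat.eq_dec w k))) l.

Lemma type_factorial_ge_1 l w : 1 <= type_factorial l w.
Proof.
  transitivity (lprod (fun _ => 1) l); [right; symmetry; apply big_unit|].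
  apply lprod_le_in. intros k _. split; [lra|]. apply INR_ge_1, lt_O_fact.
Qed.

Lemma type_factorial_remove_one l w k : NoDup l -> In k l -> In k w ->
  type_factorial l w
    = INR (count_occ Nat.eq_dec w k) * type_factorial l (remove_one k w).
Proof.
  intros Hl Hkl Hkw. pose proof (remove_one_perm k w Hkw) as Hw.
  rewrite (Permutation_count_occ Nat.eq_dec) in Hw.
  apply (big_update _ _ l k); auto.
  - rewrite !Hw, count_occ_cons_eq, <- mult_INR by reflexivity. reflexivity.
  - intros i Hi. now rewrite Hw, count_occ_cons_neq by congruence.
Qed.

Lemma lsum_roots_after_removal w j n : length w = S n -> S n = (S j + list_sum w)%nat ->
  lsum (fun k => INR (j + k)) w = INR n * INR (S j).
Proof.
  intros Hlen Hroots. apply (f_equal INR) in Hroots.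
  rewrite (big_ext_in _ _ _ (fun k => INR j + INR k)) by (intros; apply plus_INR).
  rewrite big_op, lsum_const, <- INR_list_sum, Hlen.
  rewrite plus_INR, !S_INR in *. nra.
Qed.

(* Equality holds: j n! / prod_k (tau k)! forests have j roots and n + 1 vertices of which
   tau k have k children. *)
Lemma forests_of_type_count l w j n : NoDup l -> incl w l ->
  length w = S n -> S n = (j + list_sum w)%nat ->
  INR j * INR (fact n) <= INR (length (forests_of_type w)) * type_factorial l w.
Proof.
  intros Hl. revert w j. induction n as [|n IH]; intros w j Hincl Hlen Hroots.
  all: pose proof (type_factorial_ge_1 l w) as Htf.
  all: destruct j as [|j]; [rewrite Rmult_0_l; apply Rmult_le_pos; [apply pos_INR|lra]|].
  - destruct w as [|k [|]]; try discriminate. cbn in Hroots.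
    assert (k = 0%nat /\ j = 0%nat) as [-> ->] by lia.
    assert (Hleaf : (1 <= length (forests_of_type [0%nat]))%nat).
    { apply (NoDup_incl_length (l := [[Node []]])); [repeat constructor; intros []|].
      intros f [<-|[]]. now apply in_forests_of_type. }
    apply le_INR in Hleaf. cbn [fact]. simpl INR in *. nra.
  - transitivity (lsum (fun k => INR (count_occ Nat.eq_dec w k) *
      (INR (j + k) * INR (fact n))) (nodup Nat.eq_dec w)).
    { right. rewrite lsum_count_occ, lsum_scal_r by
        (apply NoDup_nodup || (intros a Ha Hout; now rewrite nodup_In in Hout)).
      rewrite (lsum_roots_after_removal w j (S n)) by assumption.
      rewrite fact_simpl, mult_INR. ring. }
    eapply Rle_trans; [|apply Rmult_le_compat_r;
      [lra|apply forests_of_type_recurrence; lia]].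
    rewrite <- lsum_scal_r. apply lsum_le_in. intros k Hk%nodup_In.
    destruct (remove_one_size k w Hk) as [Hlen' Hsum'].
    rewrite (type_factorial_remove_one l w k) by auto.
    rewrite (Rmult_comm (INR (length _))), Rmult_assoc, (Rmult_comm (type_factorial _ _)).
    apply Rmult_le_compat_l; [apply pos_INR|]. apply IH; try lia.
    intros a Ha. apply Hincl. apply (Permutation_in a (Permutation_sym (remove_one_perm k w Hk))).
    now right.
Qed.

(* Stirling's formula for each factor [tau_k!]. *)
Lemma type_factorial_le w :
  type_factorial (nodup Nat.eq_dec w) w * exp (INR (length w))
    <= lprod (fun k => INR (count_occ Nat.eq_dec w k)) w
       * (exp 1 * INR (length w)) ^ length (nodup Nat.eq_dec w).
Proof.
  set (l := nodup Nat.eq_dec w). set (occ := count_occ Nat.eq_dec w).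
  assert (Hl : NoDup l) by apply NoDup_nodup.
  assert (Hincl : incl w l) by now apply nodup_incl.
  rewrite (INR_length w) at 1.
  rewrite <- (lsum_count_occ _ w l) by (auto; intros a Ha Hout; now apply Hincl in Ha).
  rewrite <- (lprod_count_occ _ w l) by assumption.
  rewrite <- lprod_exp, <- lprod_const. unfold type_factorial. rewrite <- !big_op.
  apply lprod_le_in. intros k Hk%nodup_In. fold (occ k). rewrite Rmult_1_r.
  split; [apply Rmult_le_pos; [apply pos_INR|left; apply exp_pos]|].
  assert (Hpos : (occ k > 0)%nat) by now apply count_occ_In.
  assert (Hle : (occ k <= length w)%nat) by apply count_occ_bound.
  destruct (occ k) as [|m]; [lia|]. apply le_INR in Hle.
  eapply Rle_trans; [apply fact_exp_le|]. rewrite Rmult_comm.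
  apply Rmult_le_compat_l; [apply pow_le, pos_INR|].
  apply Rmult_le_compat_l; [left; apply exp_pos|assumption].
Qed.

Definition type_cost (w : list nat) : R :=
  INR (length w) * (exp 1 * INR (length w)) ^ length (nodup Nat.eq_dec w).

Lemma type_cost_nonneg w : 0 <= type_cost w.
Proof.
  apply Rmult_le_pos; [apply pos_INR|apply pow_le].
  apply Rmult_le_pos; [left; apply exp_pos|apply pos_INR].
Qed.

(* The last factor is the probability that a [freq w]-Bienaymé tree has type [w]. *)
Lemma freq_type_prob_ge w : length w = S (list_sum w) ->
  1 <= type_cost w * (INR (length (forests_of_type w)) * lprod (freq w) w).
Proof.
  intros Hw. unfold type_cost. set (l := nodup Nat.eq_dec w). set (n := INR (length w)).
  assert (Hn : 0 < n) by (apply lt_0_INR; lia).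
  pose proof (forests_of_type_count l w 1 (list_sum w) (NoDup_nodup _ _)
    (proj2 (nodup_incl Nat.eq_dec w w) (incl_refl w)) Hw eq_refl) as Hcount.
  rewrite Rmult_1_l in Hcount.
  pose proof (type_factorial_le w) as Hstirling. fold l n in Hstirling.
  pose proof (pow_le_fact_exp (length w)) as Hfact. fold n in Hfact.
  rewrite Hw in Hfact at 2. rewrite fact_simpl, <- Hw, mult_INR in Hfact. fold n in Hfact.
  assert (Hfreq : lprod (freq w) w
    = lprod (fun k => INR (count_occ Nat.eq_dec w k)) w * / n ^ length w).
  { rewrite <- pow_inv, <- (lprod_const (/ n) w), <- big_op. reflexivity. }
  set (occ_prod := lprod (fun k => INR (count_occ Nat.eq_dec w k)) w) in *.
  set (forests := INR (length (forests_of_type w))) in *.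
  set (cost := (exp 1 * n) ^ length l) in *.
  set (factorials := type_factorial l w) in *.
  assert (Hnn : 0 < n ^ length w) by now apply pow_lt.
  rewrite Hfreq. apply (Rmult_le_reg_r (n ^ length w)); [assumption|].
  replace (n * cost * (forests * (occ_prod * / n ^ length w)) * n ^ length w)
    with (n * (forests * (occ_prod * cost))) by (field; lra).
  rewrite Rmult_1_l. eapply Rle_trans; [apply Hfact|].
  rewrite Rmult_assoc. apply Rmult_le_compat_l; [lra|].
  transitivity (forests * factorials * exp n).
  - apply Rmult_le_compat_r; [left; apply exp_pos|assumption].
  - rewrite Rmult_assoc. apply Rmult_le_compat_l; [apply pos_INR|assumption].
Qed.

(* There are O(sqrt n) distinct degrees, and ln n = O(n^(1/8)). *)
Lemma type_cost_le w : length w = S (list_sum w) ->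
  type_cost w <= exp (35 * Rpower (INR (length w)) (5 / 8)).
Proof.
  intros Hw. pose proof (count_distinct_sq_le w) as HD. cbv zeta in HD. unfold type_cost.
  assert (Hn : 1 <= INR (length w)) by (apply INR_ge_1; lia).
  set (D := length (nodup Nat.eq_dec w)) in *. set (n := INR (length w)) in *.
  set (L := ln n). set (y := Rpower n (/ 8)). set (u := Rpower n (/ 2)).
  assert (Hy : 1 <= y) by (apply Rpower_ge_1; lra).
  assert (Hu : 1 <= u) by (apply Rpower_ge_1; lra).
  assert (HL : 0 <= L <= 8 * y).
  { pose proof (ln_le_Rpower n (/ 8) ltac:(lra) Hn) as Hln. fold L y in Hln.
    split; [now apply ln_nonneg|lra]. }
  assert (Huu : n = u * u).
  { unfold u. rewrite <- Rpower_plus, <- (Rpower_1 n) at 1 by lra. f_equal. lra. }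
  assert (Huy : Rpower n (5 / 8) = u * y).
  { unfold u, y. rewrite <- Rpower_plus. f_equal. lra. }
  assert (HDu : INR D <= 3 * u).
  { assert (HDn : (D * D <= 2 * length w + D)%nat) by lia. apply le_INR in HDn.
    rewrite plus_INR, !mult_INR in HDn. fold n in HDn. simpl (INR 2) in HDn.
    apply Rnot_lt_le. intros Hlt. nra. }
  assert (HexpL : n = exp L) by (unfold L; rewrite exp_ln; lra).
  rewrite Huy, HexpL, <- exp_plus, exp_pow, <- exp_plus. apply exp_le_compat.
  pose proof (pos_INR D).
  assert (INR D * (1 + L) <= 3 * u * (1 + 8 * y)) by (apply Rmult_le_compat; lra).
  nra.
Qed.

(** * Averaging over types *)

Section ClassMeans.

Context {A : Type} (r : A -> A -> bool) (L : list A).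
Hypothesis r_refl : forall a, r a a = true.
Hypothesis r_sym : forall a b, r a b = r b a.
Hypothesis r_congr : forall a b, r a b = true -> forall d, r a d = r b d.

Definition class_sum (g : A -> R) (a : A) : R := lsum (fun b => ind (r a b) * g b) L.

Definition class_size (a : A) : R := class_sum (fun _ => 1) a.

Definition class_mean (g : A -> R) (a : A) : R := class_sum g a / class_size a.

Lemma class_sum_le g g' a : (forall b, In b L -> g b <= g' b) -> class_sum g a <= class_sum g' a.
Proof.
  intros Hg. apply lsum_le_in. intros b Hb. apply Rmult_le_compat_l; [apply ind_bounds|auto].
Qed.

Lemma class_size_pos a : In a L -> 0 < class_size a.
Proof.
  intros Ha. apply Rlt_le_trans with (ind (r a a) * 1); [rewrite r_refl; cbn; lra|].
  apply (lsum_ge_term (fun b => ind (r a b) * 1)); [assumption|].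
  intros b _. pose proof (ind_bounds (r a b)). lra.
Qed.

Lemma class_mean_le g g' a : In a L -> (forall b, In b L -> g b <= g' b) ->
  class_mean g a <= class_mean g' a.
Proof.
  intros Ha Hg. apply Rmult_le_compat_r; [|now apply class_sum_le].
  left. now apply Rinv_0_lt_compat, class_size_pos.
Qed.

Lemma class_mean_le_1 g a : In a L -> (forall b, In b L -> g b <= 1) -> class_mean g a <= 1.
Proof.
  intros Ha Hg. eapply Rle_trans; [apply (class_mean_le g (fun _ => 1)); auto|].
  right. apply Rinv_r. pose proof (class_size_pos a Ha). lra.
Qed.

Lemma class_mean_scal g g' x a : (forall b, r a b = true -> g b = x * g' b) ->
  class_mean g a = x * class_mean g' a.
Proof.
  intros Hg. unfold class_mean, Rdiv. rewrite <- Rmult_assoc. f_equal.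
  unfold class_sum. rewrite <- lsum_scal. apply big_ext_in. intros b _.
  destruct (r a b) eqn:Hab; cbn [ind]; [rewrite Hg by assumption|]; ring.
Qed.

Lemma lsum_class_mean g : lsum (class_mean g) L = lsum g L.
Proof.
  rewrite (big_ext_in _ _ _
    (fun a => lsum (fun b => ind (r a b) * g b * / class_size a) L))
    by (intros; symmetry; apply lsum_scal_r).
  rewrite big_exchange. apply big_ext_in. intros b Hb.
  rewrite (big_ext_in _ _ _ (fun a => g b * / class_size b * (ind (r b a) * 1))).
  - rewrite lsum_scal. fold (class_sum (fun _ => 1) b) (class_size b).
    pose proof (class_size_pos b Hb). field. lra.
  - intros a _. rewrite (r_sym b a). destruct (r a b) eqn:Hab; cbn [ind]; [|ring].
    replace (class_size b) with (class_size a); [ring|].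
    apply big_ext_in. intros d _. now rewrite (r_congr a b Hab).
Qed.

End ClassMeans.

Definition same_type (t t' : tree) : bool := permb (degs t) (degs t').

Lemma same_type_refl t : same_type t t = true.
Proof. now apply permb_true. Qed.

Lemma same_type_sym t t' : same_type t t' = same_type t' t.
Proof.
  apply Bool.eq_true_iff_eq. unfold same_type. rewrite !permb_true. split; apply Permutation_sym.
Qed.

Lemma same_type_congr s t : same_type s t = true -> forall t', same_type s t' = same_type t t'.
Proof.
  intros Hst%permb_true t'. apply Bool.eq_true_iff_eq. unfold same_type.
  rewrite !permb_true. now rewrite Hst.
Qed.

Lemma weight_same_type mu t t' : same_type t t' = true -> weight mu t' = weight mu t.
Proof. intros Ht%permb_true. rewrite !weight_degs. now apply big_perm, Permutation_sym. Qed.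

Definition type_size (t : tree) : R := class_size same_type (trees_of_size (tsize t)) t.

Definition type_mean (A : tree -> bool) (t : tree) : R :=
  class_mean same_type (trees_of_size (tsize t)) (fun t' => ind (A t')) t.

Lemma type_mean_le (A A' : tree -> bool) t :
  (forall t', tsize t' = tsize t -> A t' = true -> A' t' = true) ->
  type_mean A t <= type_mean A' t.
Proof.
  intros Himp. apply class_mean_le; [apply same_type_refl|now apply in_trees_of_size|].
  intros t' Ht'%in_trees_of_size. destruct (A t') eqn:HA; [|apply ind_bounds].
  rewrite (Himp t') by assumption. apply Rle_refl.
Qed.

(* Weights are constant on types: given its type, the conditioned tree is uniform. *)
Lemma mass_type_mean mu n A :
  mass mu n A = lsum (fun t => weight mu t * type_mean A t) (trees_of_size n).
Proof.
  transitivity (lsum (fun t => weight mu t * ind (A t)) (trees_of_size n)).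
  { apply big_ext_in. intros t _. destruct (A t); cbn [ind]; ring. }
  rewrite <- (lsum_class_mean same_type)
    by auto using same_type_refl, same_type_sym, same_type_congr.
  apply big_ext_in. intros t <-%in_trees_of_size. apply class_mean_scal. intros t' Ht'.
  now rewrite (weight_same_type mu t t').
Qed.

Lemma mass_le_off_bad_types mu n A bad rho : (forall k, 0 <= mu k) -> 0 <= rho ->
  (forall t, tsize t = n -> bad t = false -> type_mean A t <= rho) ->
  mass mu n A <= rho * prob_size mu n + mass mu n bad.
Proof.
  intros Hmu Hrho Hgood. rewrite mass_type_mean, prob_size_lsum, <- lsum_scal.
  unfold mass. rewrite <- big_op. apply lsum_le_in. intros t Ht.
  pose proof (weight_nonneg mu t Hmu) as Hw. destruct (bad t) eqn:Hbad.
  - enough (type_mean A t <= 1) by nra. apply in_trees_of_size in Ht as Hsize. subst n.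
    apply class_mean_le_1; auto using same_type_refl. intros b _. apply ind_bounds.
  - apply in_trees_of_size in Ht. specialize (Hgood t Ht Hbad). nra.
Qed.

Lemma type_mean_mul_le_mass mu A t : (forall k, 0 <= mu k) ->
  type_mean A t * (type_size t * weight mu t) <= mass mu (tsize t) A.
Proof.
  intros Hmu. unfold type_mean, class_mean. fold (type_size t).
  assert (Hpos : 0 < type_size t)
    by (apply class_size_pos; [apply same_type_refl|now apply in_trees_of_size]).
  set (total := class_sum _ _ _ t).
  replace (total / type_size t * (type_size t * weight mu t)) with (total * weight mu t)
    by (field; lra).
  unfold total, class_sum. rewrite <- lsum_scal_r. apply lsum_le_in. intros t' _.
  pose proof (weight_nonneg mu t' Hmu).
  destruct (same_type t t') eqn:Htype; cbn [ind].
  - rewrite (weight_same_type mu t t' Htype) in *. destruct (A t'); cbn [ind]; lra.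
  - destruct (A t'); lra.
Qed.

Lemma type_size_ge t : INR (length (forests_of_type (degs t))) <= type_size t.
Proof.
  unfold type_size, class_size, class_sum.
  rewrite (big_ext_in _ _ _ (fun t' => ind (same_type t t'))) by (intros; ring).
  rewrite <- INR_length_filter. apply le_INR. rewrite <- (length_map (fun t' => [t']) (filter _ _)).
  apply NoDup_incl_length; [apply NoDup_forests_of_type|]. intros f Hf.
  pose proof (length_of_type _ _ Hf) as Hlen. rewrite length_degs, <- sum_degs in Hlen.
  destruct f as [|t' [|]]; cbn in Hlen; try lia.
  apply in_forests_of_type in Hf. cbn in Hf. rewrite app_nil_r in Hf.
  apply (in_map (fun t' => [t'])), filter_In. split; [|now apply permb_true].
  apply in_trees_of_size. now rewrite <- !length_degs, (Permutation_length Hf).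
Qed.

Lemma short_type_mean_le t B eps lam h :
  1 - eps <= partial_mean (freq (degs t)) B -> 0 <= lam -> lam * (INR B * INR B) <= eps ->
  0 <= eps <= / 3 ->
  type_mean (fun t' => height t' <? h)%nat t
    <= exp (- (eps * lam * (1 - 3 * eps) ^ h * INR (tsize t))) * type_cost (degs t).
Proof.
  intros Hmean Hlam Hsmall Heps.
  pose proof (freq_subprobability (degs t)) as Hfreq.
  pose proof (short_exp_small _ B eps lam Hfreq Hmean Hlam Hsmall Heps h (tsize t)) as Hshort.
  pose proof (type_mean_mul_le_mass (freq (degs t)) (fun t' => height t' <? h)%nat t
    (proj1 Hfreq)) as Hmass.
  pose proof (freq_type_prob_ge (degs t)) as Hprob. rewrite length_degs, <- weight_degs in Hprob.
  specialize (Hprob (eq_sym (sum_degs t))). pose proof (type_cost_nonneg (degs t)) as Hcost0.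
  set (cost := type_cost (degs t)) in *. set (decay := exp (- _)) in *.
  set (mean := type_mean _ t) in *. set (prob := weight _ t) in *.
  assert (Hmean0 : 0 <= mean).
  { apply Rmult_le_pos; [apply lsum_nonneg|].
    - intros t' _. apply Rmult_le_pos; apply ind_bounds.
    - left. apply Rinv_0_lt_compat, class_size_pos; [apply same_type_refl|].
      now apply in_trees_of_size. }
  assert (Hprob0 : 0 <= prob) by now apply weight_nonneg, Hfreq.
  assert (Hcost : 1 <= cost * (type_size t * prob)).
  { eapply Rle_trans; [apply Hprob|]. apply Rmult_le_compat_l; [assumption|].
    apply Rmult_le_compat_r; [assumption|apply type_size_ge]. }
  transitivity (mean * (type_size t * prob) * cost); [nra|].
  apply Rmult_le_compat_r; [assumption|lra].
Qed.

(** * Height and width of the conditioned tree *)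

(* With a truncated mean of at least [1 - mean_defect M], each generation multiplies the survival
   probability by at least [exp (- / (4 * M))], so it has order at least [n ^ (- / 4)] at height
   [M * ln n]. *)
Definition mean_defect (M : R) : R := (1 - exp (- / (4 * M))) / 3.

Lemma mean_defect_bounds M : 0 < M -> 0 < mean_defect M <= / 3.
Proof.
  intros HM. assert (HM4 : 0 < / (4 * M)) by (apply Rinv_0_lt_compat; lra).
  assert (exp (- / (4 * M)) < 1) by (rewrite <- exp_0; apply exp_increasing; lra).
  pose proof (exp_pos (- / (4 * M))). unfold mean_defect. lra.
Qed.

(* The cost exp(O(n^(5/8))) of fixing the type is beaten by the gain exp(-c n^(3/4)). *)
Lemma short_type_mean_eventually_small M B eps : 0 < M -> 0 < eps ->
  exists N, forall t, (N <= tsize t)%nat ->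
    1 - mean_defect M <= partial_mean (freq (degs t)) B ->
    type_mean (fun t' => Rleb (INR (height t')) (M * ln (INR (tsize t)))) t <= eps.
Proof.
  intros HM Heps. pose proof (mean_defect_bounds M HM) as [He He3].
  set (r := exp (- / (4 * M))). assert (Hr : 0 < r) by apply exp_pos.
  set (e := mean_defect M) in *.
  assert (Hre : 1 - 3 * e = r) by (unfold e, mean_defect, r; field).
  destruct (exists_laplace_scale B e He) as (lam & Hlam & Hsmall).
  set (c := e * lam * r).
  assert (Hc : 0 < c) by (unfold c; apply Rmult_lt_0_compat; [nra|assumption]).
  destruct (Rpower_dominates (3 / 4) (5 / 8) c 35 (- ln eps)) as [N HN]; [lra|assumption|].
  exists N. intros t HNt Hmean. pose proof (tsize_pos t) as Hpos.
  specialize (HN (tsize t) HNt).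
  assert (Hcost : type_cost (degs t) <= exp (35 * Rpower (INR (tsize t)) (5 / 8))).
  { rewrite <- (length_degs t). apply type_cost_le. rewrite length_degs. symmetry.
    apply sum_degs. }
  set (n := tsize t) in *. apply INR_ge_1 in Hpos.
  destruct (exists_nat_ceil (M * ln (INR n))) as (h & Hh1 & Hh2).
  { apply Rmult_le_pos; [lra|now apply ln_nonneg]. }
  transitivity (type_mean (fun t' => height t' <? h)%nat t).
  { apply type_mean_le. intros t' _ Hshort. apply Nat.ltb_lt, INR_lt.
    destruct (Rleb_spec (INR (height t')) (M * ln (INR n))); [lra|discriminate]. }
  eapply Rle_trans; [apply (short_type_mean_le t B e lam h); auto; lra|].
  fold n. rewrite Hre. rewrite <- (exp_ln eps) by assumption.
  transitivity (exp (- (c * Rpower (INR n) (3 / 4))) * exp (35 * Rpower (INR n) (5 / 8))).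
  2:{ rewrite <- exp_plus. apply exp_le_compat. lra. }
  apply Rmult_le_compat; [left; apply exp_pos|apply type_cost_nonneg| |exact Hcost].
  apply exp_le_compat, Ropp_le_contravar. unfold c.
  pose proof (exp_pow_ceil_log_ge (/ (4 * M)) M (INR n) h) as Hrh. fold r in Hrh.
  replace (/ (4 * M) * M) with (/ 4) in Hrh by (field; lra).
  replace (3 / 4) with (- / 4 + 1) by lra. rewrite Rpower_plus, Rpower_1 by lra.
  transitivity (e * lam * (r * Rpower (INR n) (- / 4)) * INR n); [right; ring|].
  apply Rmult_le_compat_r; [lra|]. apply Rmult_le_compat_l; [nra|].
  apply Hrh; [|assumption]. left. apply Rinv_0_lt_compat. lra.
Qed.

Lemma height_superlogarithmic mu M eps : critical_offspring mu -> 0 < M -> 0 < eps ->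
  exists N, forall n, (N <= n)%nat -> 0 < prob_size mu n ->
    Pcond mu n (fun t => Rleb (INR (height t)) (M * ln (INR n))) < eps.
Proof.
  intros Hcrit HM Heps.
  destruct (mean_defect_bounds M HM) as [He _]. set (e := mean_defect M) in *.
  destruct (low_mean_exp_small mu e Hcrit He) as (B & c & Hc & Hbad).
  destruct (short_type_mean_eventually_small M B (eps / 2) HM) as [N1 HN1]; [lra|].
  destruct (exp_negligible mu c (eps / 2) Hcrit Hc) as [N2 HN2]; [lra|].
  exists (S (N1 + N2)). intros n Hn Hp. apply Pcond_lt; [assumption|].
  eapply Rle_lt_trans.
  { apply (mass_le_off_bad_types mu n _
      (fun t => Rltb (partial_mean (freq (degs t)) B) (1 - e)) (eps / 2) (proj1 Hcrit)); [lra|].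
    intros t Ht Hgood. subst n. apply HN1; [lia|].
    now destruct (Rltb_spec (partial_mean (freq (degs t)) B) (1 - e)). }
  specialize (Hbad n). specialize (HN2 n ltac:(lia) Hp).
  assert (Hn1 : 1 <= INR n) by (apply INR_ge_1; lia).
  pose proof (exp_pos (- (c * INR n))). nra.
Qed.

Lemma width_attained t : (0 < width t)%nat ->
  exists k, (k < tsize t)%nat /\ width t = gen k t.
Proof.
  intros Hpos. unfold width in *. fold (list_max (map (fun k => gen k t) (seq 0 (tsize t)))) in *.
  destruct (list_max_cases (map (fun k => gen k t) (seq 0 (tsize t)))) as [Hzero|Hin]; [lia|].
  apply in_map_iff in Hin as (k & Hk & Hlt%in_seq). exists k. split; [lia|congruence].
Qed.

Lemma wide_le_sum_gen mu n delta : (forall k, 0 <= mu k) -> 0 <= delta ->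
  mass mu n (fun t => Rltb (delta * INR n) (INR (width t)))
    <= lsum (fun k => mass mu n (fun t => Rltb (delta * INR n) (INR (gen k t)))) (seq 0 n).
Proof.
  intros Hmu Hdelta. unfold mass. rewrite big_exchange. apply lsum_le_in.
  intros t Ht%in_trees_of_size.
  assert (Hterm : forall k, 0 <= if Rltb (delta * INR n) (INR (gen k t)) then weight mu t else 0).
  { intros k. pose proof (weight_nonneg mu t Hmu). destruct (Rltb _ _); lra. }
  destruct (Rltb_spec (delta * INR n) (INR (width t))) as [Hlt|_]; [|now apply lsum_nonneg].
  destruct (width_attained t) as (k & Hk & Hwidth).
  { apply INR_lt. simpl (INR 0). pose proof (pos_INR n). nra. }
  eapply Rle_trans; [|apply (lsum_ge_term _ _ k); [apply in_seq; lia|auto]].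
  cbv beta. rewrite <- Hwidth. destruct (Rltb_spec (delta * INR n) (INR (width t))); lra.
Qed.

Lemma width_sublinear mu delta eps : critical_offspring mu -> 0 < delta -> 0 < eps ->
  exists N, forall n, (N <= n)%nat -> 0 < prob_size mu n ->
    Pcond mu n (fun t => Rltb (delta * INR n) (INR (width t))) < eps.
Proof.
  intros Hcrit Hdelta Heps.
  destruct (large_gen_exp_small mu delta Hcrit Hdelta) as (c & Hc & Hgen).
  destruct (exp_negligible mu c eps Hcrit Hc Heps) as [N HN].
  exists N. intros n Hn Hp. apply Pcond_lt; [assumption|].
  eapply Rle_lt_trans; [|apply (HN n Hn Hp)].
  eapply Rle_trans; [apply wide_le_sum_gen; [apply Hcrit|lra]|].
  eapply Rle_trans; [apply lsum_le_in; intros; apply Hgen|].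
  rewrite lsum_const, length_seq. apply Rle_refl.
Qed.

Theorem theorem1 (mu : nat -> R) (Hmu : critical_offspring mu) :
  (* Height(T_n) / ln n -> +oo in probability *)
  (forall M : R, 0 < M -> forall eps : R, 0 < eps ->
     exists N : nat, forall n : nat, (N <= n)%nat -> 0 < prob_size mu n ->
       Pcond mu n (fun t => if Rle_dec (INR (height t)) (M * ln (INR n))
                            then true else false) < eps) /\
  (* Width(T_n) / n -> 0 in probability *)
  (forall delta : R, 0 < delta -> forall eps : R, 0 < eps ->
     exists N : nat, forall n : nat, (N <= n)%nat -> 0 < prob_size mu n ->
       Pcond mu n (fun t => if Rlt_dec (delta * INR n) (INR (width t))
                            then true else false) < eps).
Proof.
  split; intros.
  - now apply height_superlogarithmic.
  - now apply width_sublinear.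
Qed.
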